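(* Let $A$ be a semisimple Banach algebra and let $a,b\in\mathrm{Soc}(A)$. If $\rho(a,b)=0$, then $\det(1+\lambda a)=\det(1+\lambda b)$ for all $\lambda\in\mathbb{C}$.
   Context: Banach algebras are over $\mathbb{C}$ and have a unit $1$; $\sigma(x)$ is the spectrum of $x\in A$ and $\sigma'(x)=\sigma(x)\setminus\{0\}$. For $a,b\in A$ let $C_{a,b}:A\to A$ be the bounded operator $C_{a,b}x=ax-xb$, and put $\rho(a,b)=\limsup_{n\to\infty}\|C_{a,b}^n1\|^{1/n}$. $\mathrm{Soc}(A)$ (the socle) is the two-sided ideal of all finite sums of rank one elements, where $0\neq u\in A$ is rank one if $uAu\subseteq\mathbb{C}u$ (the zero element is included as the empty sum); every element of $\mathrm{Soc}(A)$ has finite spectrum. For $a\in A$ let $\mathrm{rank}(a)=\sup_{x\in A}\#\sigma'(xa)\le\infty$, where $\#K$ is the number of distinct elements of $K\subseteq\mathbb{C}$. For $a\in\mathrm{Soc}(A)$ the rank is finite and $E(a)=\{x\in A:\#\sigma'(xa)=\mathrm{rank}(a)\}$ is open and dense in $A$. Multiplicity (Aupetit–Mouton): for $a\in\mathrm{Soc}(A)$ and $\lambda\in\sigma(a)$, let $V_\lambda$ be an open disk centered at $\lambda$ whose closure contains no other point of $\sigma(a)$. There is an open ball $U\subset A$ centered at $1$ such that $\#[\sigma(xa)\cap V_\lambda]$ is constant for $x\in E(a)\cap U$; this constant is the multiplicity $m(\lambda,a)$ of $a$ at $\lambda$. Determinant: for $c\in\mathrm{Soc}(A)$, $\det(1+c)=\prod_{\mu\in\sigma(c)}(1+\mu)^{m(\mu,c)}$.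 *)

(* Defs.v *)
From HB Require Import structures.
From mathcomp Require Import all_boot all_order all_algebra.
From mathcomp Require Import all_classical all_reals all_analysis.
From mathcomp Require Import complex.

Set Implicit Arguments.
Unset Strict Implicit.
Unset Printing Implicit Defensive.

Import Order.TTheory GRing.Theory Num.Theory.
Import numFieldNormedType.Exports.

Local Open Scope classical_set_scope.
Local Open Scope ring_scope.
Local Open Scope complex_scope.

(* Unital Banach algebras; the normalization |1| = 1 is not required.  A record
   rather than an HB structure: HB rejects a structure that joins rings and
   normed modules without Num.NumDomain inheriting from it.  The instances below
   make a banachAlgType K both a completeNormedModType K and an algType K. *)
Record banachAlgType (K : numFieldType) := BanachAlgebra {
  banach_space : completeNormedModType K;
  banach_one : banach_space;
  banach_mul : banach_space -> banach_space -> banach_space;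
  banach_mulA : associative banach_mul;
  banach_mul1r : left_id banach_one banach_mul;
  banach_mulr1 : right_id banach_one banach_mul;
  banach_mulDl : left_distributive banach_mul +%R;
  banach_mulDr : right_distributive banach_mul +%R;
  banach_oner_neq0 : banach_one != 0;
  banach_scalerAl : forall (k : K) x y,
    k *: banach_mul x y = banach_mul (k *: x) y;
  banach_scalerAr : forall (k : K) x y,
    k *: banach_mul x y = banach_mul x (k *: y);
  banach_normrM : forall x y, `|banach_mul x y| <= `|x| * `|y|
}.

Definition banach_sort (K : numFieldType) (A : banachAlgType K) : Type :=
  banach_space A.
Coercion banach_sort : banachAlgType >-> Sortclass.

HB.instance Definition _ (K : numFieldType) (A : banachAlgType K) :=
  CompleteNormedModule.copy (banach_sort A) (banach_space A).
HB.instance Definition _ (K : numFieldType) (A : banachAlgType K) :=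
  GRing.Zmodule_isNzRing.Build (banach_sort A) (@banach_mulA K A)
    (@banach_mul1r K A) (@banach_mulr1 K A) (@banach_mulDl K A)
    (@banach_mulDr K A) (@banach_oner_neq0 K A).
HB.instance Definition _ (K : numFieldType) (A : banachAlgType K) :=
  GRing.Lmodule_isLalgebra.Build K (banach_sort A) (@banach_scalerAl K A).
HB.instance Definition _ (K : numFieldType) (A : banachAlgType K) :=
  GRing.Lalgebra_isAlgebra.Build K (banach_sort A) (@banach_scalerAr K A).

Lemma normrM_le (K : numFieldType) (A : banachAlgType K) (x y : A) :
  `|x * y| <= `|x| * `|y|.
Proof. exact: banach_normrM. Qed.

Section Semisimple.
Variable A : nzRingType.

Definition left_ideal (I : set A) : Prop :=
  [/\ I 0, forall x y, I x -> I y -> I (x + y) & forall x y, I y -> I (x * y)].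

Definition maximal_left_ideal (I : set A) : Prop :=
  [/\ left_ideal I, I != setT &
      forall J, left_ideal J -> I `<=` J -> J = I \/ J = setT].

Definition radical : set A := \bigcap_(I in maximal_left_ideal) I.

Definition semisimple : Prop := radical = [set 0].

Definition invertible (x : A) : Prop := exists y, y * x = 1 /\ x * y = 1.

End Semisimple.

Section BanachAlgebraTheory.
Variables (R : realType) (A : banachAlgType R[i]).
Implicit Types (a b c u x : A) (l mu : R[i]) (n m : nat).

Definition spectrum x : set R[i] := [set l | ~ invertible (l%:A - x)].

Definition nonzero_spectrum x : set R[i] := spectrum x `\ 0.

Definition commutator_op a b x : A := a * x - x * b.

(* The norm of A takes its (nonnegative real) values in R[i], whence Re.  The
   value of the sequence at n = 0 is irrelevant to the limsup. *)
Definition rho a b : \bar R :=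
  limn_esup (fun n =>
    (complex.Re `|iter n (commutator_op a b) 1| `^ n%:R^-1)%:E).

Definition rank_one u : Prop :=
  u != 0 /\ forall x, exists l, u * x * u = l *: u.

Definition socle : set A :=
  [set a | exists s : seq A,
     (forall u, u \in s -> rank_one u) /\ a = \sum_(u <- s) u].

Definition rank a : \bar R :=
  ereal_sup [set counting (nonzero_spectrum (x * a)) | x in [set: A]].

Definition rank_attained a : set A :=
  [set x | counting (nonzero_spectrum (x * a)) = rank a].

Definition is_multiplicity l a m : Prop :=
  forall r : R[i], 0 < r ->
    closure (ball (l : R[i]^o) r) `&` spectrum a `<=` [set l] ->
    exists2 e : R[i], 0 < e &
      forall x, rank_attained a x -> ball (1 : A) e x ->
        counting (spectrum (x * a) `&` ball (l : R[i]^o) r) = m%:R%:E :> \bar R.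

(* Meaningful for a in socle and l in spectrum a, in which case there is exactly
   one m such that is_multiplicity l a m. *)
Definition multiplicity l a : nat := xget 0%N (is_multiplicity l a).

(* det1D c is the determinant of 1 + c. *)
Definition det1D c : R[i] :=
  \big[*%R/1]_(mu \in spectrum c) (1 + mu) ^+ multiplicity mu c.

End BanachAlgebraTheory.

(* Main.v *)
From HB Require Import structures.
Require Import Defs.
From mathcomp Require Import all_boot all_order all_algebra separable.
From mathcomp Require Import all_classical all_reals all_analysis.
From mathcomp Require Import complex.

Set Implicit Arguments.
Unset Strict Implicit.
Unset Printing Implicit Defensive.

Import Order.TTheory GRing.Theory Num.Theory.
Import numFieldNormedType.Exports.

Local Open Scope classical_set_scope.
Local Open Scope ring_scope.
Local Open Scope complex_scope.

(** The proof has two halves: the spectral idempotents of [a] and [b] at every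
    nonzero point coincide, and the multiplicity of a nonzero point is the trace
    of the spectral idempotent there.

    First half.  Let [C x = a x - x b].  The hypothesis says that the iterates
    [C^n 1] decay faster than every geometric sequence.  Left multiplication by
    [a] and right multiplication by [b] commute with [C], so every [f(a) g(b)]
    with [f], [g] polynomials decays in the same sense.  If [w] decays, is
    killed on the left by a polynomial in [a] and on the right by a polynomial
    in [b], and the two polynomials have no common root, then [w] is a sum of
    generalized eigenvectors of [C] for nonzero eigenvalues, so that [w = 0]
    ([decaying_intertwiner]).  Elements of the socle are algebraic, hence for
    [mu != 0] a Bezout relation provides one polynomial [Q] such that [Q(a)] and
    [Q(b)] are the spectral idempotents of [a] and of [b] at [mu].  Applied to
    [Q(a) (1 - Q)(b)] and to [(1 - Q)(a) Q(b)], the vanishing statement gives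
    [Q(a) = Q(a) Q(b) = Q(b)].

    Second half.  In a semisimple algebra, an element [a] of the socle satisfies
    [a = a s] where [s], a sum of [n] orthogonal minimal idempotents, lies in
    [A a] ([socle_support]).  Minimal idempotents carry matrix coordinates
    [Phi : A -> 'M_n] ([matrix_rep_exists]), and the nonzero spectrum of [x a] is
    the set of nonzero eigenvalues of [Phi (x a)].  Because [s] is in [A a], some
    [x a] has [n] distinct nonzero eigenvalues; hence [a] has rank [n], and the
    rank is attained at [x] exactly when the eigenvalues of [Phi (x a)] are
    nonzero and simple.  Such [x] are found arbitrarily close to [1] (a resultant
    along a line through [1] does not vanish identically), and for them the
    number of points of the spectrum of [x a] in a small disk around [mu] is
    the algebraic multiplicity of [mu] as an eigenvalue of [Phi a], because the
    roots of a monic polynomial depend continuously on its coefficients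
    ([roots_cvg], [multiplicity_count]).  This algebraic multiplicity is the
    trace of [Phi p] for the spectral idempotent [p] at [mu], and the trace of an
    idempotent does not depend on the minimal idempotents in which the
    coordinates are taken ([rep_trace_indep]).

    The two halves give equal multiplicities at each nonzero point.  The point 0
    contributes the factor 1 to a determinant whatever its multiplicity. *)

(** * Characteristic polynomials *)

Lemma trig_mx_horner (C : comNzRingType) n (T : 'M[C]_n.+1) (q : {poly C}) :
  is_trig_mx T ->
  is_trig_mx (horner_mx T q) /\ forall i, horner_mx T q i i = q.[T i i].
Proof.
move=> /is_trig_mxP trT; elim/poly_ind: q => [|q c [/is_trig_mxP trq dq]].
  by rewrite rmorph0; split=> [|i]; [exact: mx0_is_trig | rewrite mxE horner0].
rewrite rmorphD rmorphM /= horner_mx_C horner_mx_X; split=> [|i].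
  apply/is_trig_mxP => i j ij; rewrite !mxE -val_eqE (ltn_eqF ij) mulr0n addr0.
  rewrite big1 // => k _; case: (ltnP i k) => [ik|ki]; first by rewrite trq ?mul0r.
  by rewrite trT ?mulr0 // (leq_ltn_trans ki).
rewrite !mxE eqxx mulr1n hornerMXaddC -dq (bigD1 i) //= big1 ?addr0 // => k ki.
case: (ltngtP i k) => [ik|ik|/val_inj ik]; first by rewrite trq ?mul0r.
  by rewrite trT ?mulr0.
by rewrite ik eqxx in ki.
Qed.

Lemma char_poly_conj (C : comUnitRingType) n (P M : 'M[C]_n) : P \in unitmx ->
  char_poly (P *m M *m invmx P) = char_poly M.
Proof.
move=> uP; rewrite /char_poly.
have -> : char_poly_mx (P *m M *m invmx P) =
    map_mx polyC P *m char_poly_mx M *m map_mx polyC (invmx P).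
  rewrite /char_poly_mx mulmxBr mulmxBl !map_mxM /=; congr (_ - _).
  rewrite scalar_mxC -mulmxA -map_mxM mulmxV //.
  by rewrite (map_mx1 (@polyC C)) mulmx1.
rewrite !det_mulmx mulrC mulrA -det_mulmx -map_mxM mulVmx //.
by rewrite map_mx1 det1 mul1r.
Qed.

(** Immediate for triangular matrices; Schur's theorem reduces to them. *)
Lemma mxtrace_horner (C : numClosedFieldType) n (M : 'M[C]_n.+1) (s : seq C) q :
  char_poly M = \prod_(z <- s) ('X - z%:P) ->
  \tr (horner_mx M q) = \sum_(z <- s) q.[z].
Proof.
move=> chM; have [P uP] := Schur M isT.
rewrite /similar_to; set T := conjmx P M => trT.
have uP' := unitarymx_unit uP.
have TE : T = P *m M *m invmx P by rewrite /T conjumx.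
have -> : \tr (horner_mx M q) = \tr (horner_mx T q).
  by rewrite TE horner_mx_uconj // -mulmxA mxtrace_mulC -mulmxA mulVmx ?mulmx1.
have [_ dT] := trig_mx_horner q trT.
rewrite /mxtrace (eq_bigr (fun i => q.[T i i])) => [|i _]; last by rewrite dT.
rewrite (eq_bigr (fun i => (fun z => q.[z]) (T i i))) //.
rewrite -(big_map (fun i => T i i) predT (fun z => q.[z])) /=.
apply: perm_big; apply: prod_XsubC_eq.
by rewrite -chM -(char_poly_conj M uP') -TE char_poly_trig // big_map.
Qed.

Lemma resultant_neq0 (F : fieldType) (p q : {poly F}) : p != 0 ->
  (resultant p q != 0) = coprimep p q.
Proof.
move=> p0; rewrite resultant_eq0 coprimep_def -leqNgt eqn_leq andbC.
by rewrite lt0n size_poly_eq0 gcdp_eq0 (negPf p0).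
Qed.

(** Along the line [M + t N] the discriminant of the characteristic polynomial,
    times its constant term, is a polynomial in [t]. *)
Lemma line_char_poly (C : numFieldType) n (M N : 'M[C]_n) (t0 : C) :
  separable_poly (char_poly (M + t0 *: N)) ->
  ~~ root (char_poly (M + t0 *: N)) 0 ->
  exists2 D : {poly C}, D != 0 & forall t, D.[t] != 0 ->
    separable_poly (char_poly (M + t *: N)) /\
    ~~ root (char_poly (M + t *: N)) 0.
Proof.
case: n => [|n] in M N * => sep nr.
  by exists 1 => [|t _]; rewrite ?oner_neq0 // !flatmx0 in sep nr *.
pose L := map_mx polyC M + 'X *: map_mx polyC N.
pose p := char_poly L.
have pt t : map_poly (horner_eval t) p = char_poly (M + t *: N).
  rewrite map_char_poly; congr char_poly; apply/matrixP => i j.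
  by rewrite !mxE /= /horner_eval hornerD hornerM hornerX !hornerC.
have szp : size p = n.+2 by exact: size_char_poly.
have lp : lead_coef p = 1 by apply/monicP; exact: char_poly_monic.
have cp' : p^`()`_n = n.+1%:R.
  by rewrite coef_deriv; move: lp; rewrite lead_coefE szp /= => ->.
(* The leading coefficients of [p] and [p'] are the constants 1 and [n.+1], so
   the resultant commutes with the evaluation at [t]. *)
have szp' : size p^`() = n.+1.
  apply/eqP; rewrite eqn_leq; apply/andP; split.
    by rewrite -ltnS -szp lt_size_deriv // -size_poly_eq0 szp.
  rewrite ltnNge; apply/negP => /(nth_default 0); rewrite cp'.
  by move/eqP; rewrite -polyC_natr polyC_eq0 pnatr_eq0.
pose D := resultant p p^`() * p`_0.
have Dt t : (D.[t] != 0) = separable_poly (char_poly (M + t *: N)) &&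
    ~~ root (char_poly (M + t *: N)) 0.
  rewrite /D hornerM mulf_eq0 negb_or.
  have := @map_resultant _ _ (horner_eval t) p p^`().
  rewrite lp lead_coefE szp' /= cp' rmorph1 rmorph_nat oner_neq0 pnatr_eq0.
  move=> /(_ isT isT); rewrite {1}/horner_eval => ->.
  rewrite -deriv_map pt resultant_neq0 ?monic_neq0 ?char_poly_monic //.
  by rewrite unlock /root horner_coef0 -pt coef_map.
exists D => [|t]; last by rewrite Dt => /andP.
by apply/eqP => D0; have := Dt t0; rewrite D0 horner0 eqxx sep nr.
Qed.

Lemma nonroot_small (C : numFieldType) (D : {poly C}) (e : C) : D != 0 ->
  0 < e -> exists2 t, `|t| < e & D.[t] != 0.
Proof.
move=> D0 e0; pose s := [seq e / k.+2%:R | k <- iota 0 (size D)].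
have us : uniq s.
  rewrite map_inj_uniq ?iota_uniq // => i j /(mulfI (lt0r_neq0 e0)).
  by move=> /invr_inj /eqP; rewrite eqr_nat => /eqP [].
have /allPn [t ts nt] : ~~ all (root D) s.
  apply/negP => al; have := max_poly_roots D0 al us.
  by rewrite size_map size_iota ltnn.
exists t => //; have /mapP [k _ ->] := ts.
rewrite ger0_norm ?divr_ge0 ?ltW // ltr_pdivrMr ?ltr0n //.
by rewrite ltr_pMr // ltr1n.
Qed.

(** * Continuity of the roots of a polynomial *)

Section RootContinuity.
Variables (K : numClosedFieldType) (T : Type) (F : set_system T).
Context {FF : Filter F}.

Definition coef_cvg (Q : T -> {poly K}) (P : {poly K}) :=
  forall k, (fun x => (Q x)`_k : K^o) @ F --> (P`_k : K^o).

Lemma coef_cvg_cst P : coef_cvg (fun=> P) P.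
Proof. by move=> k; exact: cvg_cst. Qed.

Lemma coef_cvgC (f : T -> K) (l : K) : (f : T -> K^o) @ F --> (l : K^o) ->
  coef_cvg (fun x => (f x)%:P) l%:P.
Proof.
move=> fl k; rewrite coefC.
under eq_fun do rewrite coefC.
by case: (k == 0)%N => //; exact: cvg_cst.
Qed.

Lemma coef_cvgD P Q p q : coef_cvg P p -> coef_cvg Q q ->
  coef_cvg (fun x => P x + Q x) (p + q).
Proof.
move=> Pp Qq k; rewrite coefD; under eq_fun do rewrite coefD.
by apply: cvgD.
Qed.

Lemma coef_cvgM P Q p q : coef_cvg P p -> coef_cvg Q q ->
  coef_cvg (fun x => P x * Q x) (p * q).
Proof.
move=> Pp Qq k; rewrite coefM; under eq_fun do rewrite coefM.
apply: cvg_big => [|i _]; first exact: add_continuous.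
by apply: cvgM.
Qed.

Lemma coef_cvg_sum (I : Type) (r : seq I) (Q : I -> T -> {poly K}) q :
  (forall i, coef_cvg (Q i) (q i)) ->
  coef_cvg (fun x => \sum_(i <- r) Q i x) (\sum_(i <- r) q i).
Proof.
move=> Qq; elim: r => [|i r IH].
  by under eq_fun do rewrite big_nil; rewrite big_nil; exact: coef_cvg_cst.
by under eq_fun do rewrite big_cons; rewrite big_cons; exact: coef_cvgD.
Qed.

Lemma coef_cvg_prod (I : Type) (r : seq I) (Q : I -> T -> {poly K}) q :
  (forall i, coef_cvg (Q i) (q i)) ->
  coef_cvg (fun x => \prod_(i <- r) Q i x) (\prod_(i <- r) q i).
Proof.
move=> Qq; elim: r => [|i r IH].
  by under eq_fun do rewrite big_nil; rewrite big_nil; exact: coef_cvg_cst.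
by under eq_fun do rewrite big_cons; rewrite big_cons; exact: coef_cvgM.
Qed.

Lemma coef_cvg_char_poly n (M : T -> 'M[K]_n) (N : 'M[K]_n) :
  (forall i j, (fun x => M x i j : K^o) @ F --> (N i j : K^o)) ->
  coef_cvg (fun x => char_poly (M x)) (char_poly N).
Proof.
move=> MN; rewrite /char_poly /determinant.
apply: coef_cvg_sum => s; apply: coef_cvgM; first exact: coef_cvg_cst.
apply: coef_cvg_prod => i; rewrite !mxE; under eq_fun do rewrite !mxE.
apply: coef_cvgD; first exact: coef_cvg_cst.
rewrite -polyCN; under eq_fun do rewrite -polyCN.
by apply: coef_cvgC; apply: cvgN.
Qed.

(** The witness is the minimum of the list; it is built inductively since the
    order of the field is only partial. *)
Lemma exists_exp_le_prod (d : seq K) : (0 < size d)%N -> all (>= 0) d ->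
  exists2 y, y \in d & y ^+ size d <= \prod_(z <- d) z.
Proof.
elim: d => // x [|z d] IH _ /andP [x0 d0].
  by exists x; rewrite ?mem_head // big_cons big_nil mulr1.
have [//|//|y yd yle] := IH; 
have {}d0 : all (>= 0) (z :: d) := d0.
have y0 : 0 <= y by have := allP d0 y yd.
rewrite big_cons.
have [xy|yx] := real_leP (ger0_real x0) (ger0_real y0).
  exists x; first by rewrite mem_head.
  rewrite (exprS x (size (z :: d))) ler_wpM2l //.
  by apply: le_trans yle; rewrite lerXn2r.
exists y; first by rewrite inE yd orbT.
by rewrite (exprS y (size (z :: d))) ler_pM // ?exprn_ge0 // ltW.
Qed.

Lemma monic_factor (Q : {poly K}) : Q \is monic ->
  exists2 r : seq K, Q = \prod_(z <- r) ('X - z%:P) & size r = (size Q).-1.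
Proof.
move=> mQ; have [r] := closed_field_poly_normal Q.
rewrite (monicP mQ) scale1r => Qr; exists r => //.
by rewrite Qr size_prod_XsubC.
Qed.

(** [|Q(z)|] is the product of the distances from [z] to the roots of [Q], so
    the nearest root is close to [z] when [|Q(z)|] is small. *)
Lemma near_root (Q : {poly K}) (z : K) n : Q \is monic -> size Q = n.+2 ->
  exists2 y, root Q y & `|z - y| ^+ n.+1 <= `|Q.[z]|.
Proof.
move=> mQ sQ; have [r Qr sr] := monic_factor mQ.
pose d := [seq `|z - y| | y <- r].
have sd : size d = n.+1 by rewrite size_map sr sQ.
have [||y /mapP [w wr ->]] := @exists_exp_le_prod d.
- by rewrite sd.
- by apply/allP => _ /mapP [y _ ->]; exact: normr_ge0.
rewrite sd big_map => le_w; exists w; first by rewrite Qr root_prod_XsubC.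
apply: le_trans le_w _; rewrite Qr horner_prod normr_prod.
by under [leRHS]eq_bigr do rewrite hornerXsubC.
Qed.

(** By induction on the degree: [Q x] has a root [y x] converging to a given root
    of the limit polynomial, and the coefficients of [Q x / ('X - y x)] are
    obtained from those of [Q x] by Horner's recursion, hence converge too. *)
Lemma roots_cvg (s : seq K) (Q : T -> {poly K}) :
  (forall x, Q x \is monic) -> (forall x, size (Q x) = (size s).+1) ->
  coef_cvg Q (\prod_(z <- s) ('X - z%:P)) ->
  exists r : T -> seq K,
    [/\ forall x, size (r x) = size s,
        forall x, Q x = \prod_(z <- r x) ('X - z%:P) &
        forall i, (i < size s)%N ->
          (fun x => (r x)`_i : K^o) @ F --> (s`_i : K^o)].
Proof.
elim: s Q => [|z s IH] Q mQ sQ QP.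
  exists (fun=> [::]); split=> // x; rewrite big_nil.
  have /eqP/size_poly1P [c c0 Qc] := sQ x.
  by rewrite Qc; move: (mQ x); rewrite Qc monicE lead_coefC => /eqP ->.
set P := \prod_(_ <- _) _ in QP.
have Pz : P.[z] = 0 by rewrite /P big_cons hornerM hornerXsubC subrr mul0r.
(* [y x] is a root of [Q x] that tends to [z]. *)
have /choice [y yP] : forall x, exists y,
    root (Q x) y /\ `|z - y| ^+ (size s).+1 <= `|(Q x).[z]|.
  by move=> x; have [y] := near_root z (mQ x) (sQ x); exists y.
have Qz : (fun x => (Q x).[z] : K^o) @ F --> (0 : K^o).
  rewrite -Pz (@horner_coef_wide _ (size s).+2) ?size_prod_XsubC //.
  under eq_fun do rewrite (@horner_coef_wide _ (size s).+2) ?sQ //.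
  apply: cvg_big => [|i _]; first exact: add_continuous.
  by apply: cvgM; [exact: QP|exact: cvg_cst].
have yz : (y : T -> K^o) @ F --> (z : K^o).
  apply/cvgrPdist_lt => e e0.
  have en : 0 < e ^+ (size s).+1 by exact: exprn_gt0.
  move/cvgrPdist_lt : Qz => /(_ _ en); apply: filterS => x.
  rewrite sub0r normrN => lt_e; have [_ le_y] := yP x.
  have := le_lt_trans le_y lt_e.
  by rewrite ltr_pXn2r ?nnegrE ?normr_ge0 ?ltW.
have /choice [q qP] : forall x, exists q, Q x = q * ('X - (y x)%:P).
  by move=> x; apply/factor_theorem; case: (yP x).
have mq x : q x \is monic by have := mQ x; rewrite qP monicMr ?monicXsubC.
have sq x : size (q x) = (size s).+1.
  by have := sQ x; rewrite qP size_Mmonic ?monicXsubC ?monic_neq0 // size_XsubC addn2 => -[].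
pose p := \prod_(w <- s) ('X - w%:P).
have PE : P = p * ('X - z%:P) by rewrite /P big_cons mulrC.
have coefE (u : {poly K}) w k : u`_k = (u * ('X - w%:P))`_k.+1 + u`_k.+1 * w.
  by rewrite mulrBr coefB coefMX coefMC subrK.
have qp : coef_cvg q p.
  (* Horner's recursion computes the coefficients from the top down. *)
  suff H m : forall k, (size s <= k + m)%N ->
      (fun x => (q x)`_k : K^o) @ F --> (p`_k : K^o).
    by move=> k; apply: (H (size s)); rewrite leq_addl.
  elim: m => [|m IHm] k km.
    rewrite (coefE p z) -PE; under eq_fun => x do rewrite (coefE (q x) (y x)) -qP.
    have zk (u : {poly K}) : size u = (size s).+1 -> u`_k.+1 = 0.
      by move=> su; apply: nth_default; rewrite su ltnS -(addn0 k).
    rewrite (zk p) ?size_prod_XsubC // mul0r addr0.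
    by under eq_fun => x do rewrite (zk _ (sq x)) mul0r addr0; exact: QP.
  rewrite (coefE p z) -PE; under eq_fun => x do rewrite (coefE (q x) (y x)) -qP.
  apply: cvgD; first exact: QP.
  by apply: cvgM => //; apply: IHm; rewrite addSnnS.
have [r [sr Er cr]] := IH q mq sq qp.
exists (fun x => y x :: r x); split=> [x|x|[|i] ilt] /=.
- by rewrite sr.
- by rewrite big_cons -Er qP mulrC.
- exact: yz.
- exact: cr.
Qed.

End RootContinuity.

(** * Minimal idempotents in the socle *)

(** If a maximal left ideal [I] misses [c] then [I + A c] contains 1, so that
    [1 - y c] is in [I] for some [y]; but [(y c)^2 = 0] makes it invertible. *)
Lemma semisimple_semiprime (A : nzRingType) : semisimple A ->
  forall c : A, (forall y, c * y * c = 0) -> c = 0.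
Proof.
move=> ssA c cAc; suff : radical c by rewrite ssA.
move=> I [[I0 ID IM] InT maxI]; apply: contrapT => nIc.
pose J := [set x : A | exists i y, I i /\ x = i + y * c].
have J_ideal : left_ideal J.
  split; first by exists 0, 0; rewrite mul0r addr0.
  - move=> _ _ [i [y [Ii ->]]] [j [z [Ij ->]]].
    exists (i + j), (y + z); split; first exact: ID.
    by rewrite mulrDl addrACA.
  - move=> x _ [i [y [Ii ->]]]; exists (x * i), (x * y); split; first exact: IM.
    by rewrite mulrDr mulrA.
have IJ : I `<=` J by move=> i Ii; exists i, 0; rewrite mul0r addr0.
have [JI|JT] := maxI J J_ideal IJ.
  by apply: nIc; rewrite -JI; exists 0, 1; rewrite add0r mul1r.
have [i [y [Ii yc]]] : J 1 by rewrite JT.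
move/eqP: InT; apply; rewrite -subTset => x _.
rewrite -[x]mulr1; apply: (IM); suff -> : 1 = (1 + y * c) * i by exact: IM.
rewrite -(addrK (y * c) i) -yc mulrDl mul1r mulrBr mulr1.
by rewrite -mulrA (mulrA c) cAc mulr0 subr0 subrK.
Qed.

Section Socle.
Variables (R : realType) (A : banachAlgType R[i]).
Hypothesis ssA : semisimple A.
Implicit Types (a c u x y : A) (e : nat -> A) (n : nat).

Lemma semiprime c : c != 0 -> exists y, c * y * c != 0.
Proof.
move=> c0; apply: contrapT => H; move/eqP: c0; apply.
apply: (semisimple_semiprime ssA) => y; apply: contrapT => /eqP cyc.
by apply: H; exists y.
Qed.

Lemma rank_one_regular u : rank_one u -> exists y, u * y * u = u.
Proof.
move=> [u0 uAu]; have [y uyu] := semiprime u0; have [l ul] := uAu y.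
have l0 : l != 0 by apply: contra_neq uyu => l0; rewrite ul l0 scale0r.
by exists (l^-1 *: y); rewrite -scalerAr -scalerAl ul scalerA mulVf ?scale1r.
Qed.

Lemma rank_one_mull u x : rank_one u -> x * u != 0 -> rank_one (x * u).
Proof.
move=> [_ uAu] xu0; split=> // y; have [l ul] := uAu (y * x); exists l.
by rewrite scalerAr -ul !mulrA.
Qed.

Lemma rank_one_mulr u x : rank_one u -> u * x != 0 -> rank_one (u * x).
Proof.
move=> [_ uAu] ux0; split=> // y; have [l ul] := uAu (x * y); exists l.
by rewrite scalerAl -ul !mulrA.
Qed.

(** A finite family is indexed by [nat] and cut off at [n], so that it can be
    extended without changing its type.  The two clauses together say that the
    [e i] are orthogonal minimal idempotents. *)
Definition orthogonal_family n (e : nat -> A) :=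
  (forall i, (i < n)%N -> rank_one (e i)) /\
  (forall i j, (i < n)%N -> (j < n)%N -> e i * e j = e i *+ (i == j)).

Definition family_sum n (e : nat -> A) := \sum_(i < n) e i.

Lemma family_sum_mull n e i : orthogonal_family n e -> (i < n)%N ->
  e i * family_sum n e = e i.
Proof.
move=> [_ orth] ilt; rewrite /family_sum mulr_sumr (bigD1 (Ordinal ilt)) //=.
rewrite orth // eqxx mulr1n big1 ?addr0 // => j.
by rewrite -val_eqE /= orth // eq_sym => /negPf ->.
Qed.

Lemma family_sum_mulr n e i : orthogonal_family n e -> (i < n)%N ->
  family_sum n e * e i = e i.
Proof.
move=> [_ orth] ilt; rewrite /family_sum mulr_suml (bigD1 (Ordinal ilt)) //=.
rewrite orth // eqxx mulr1n big1 ?addr0 // => j.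
by rewrite -val_eqE /= orth // => /negPf ->.
Qed.

Lemma family_sum_idem n e : orthogonal_family n e ->
  family_sum n e * family_sum n e = family_sum n e.
Proof.
move=> fe; rewrite {1}/family_sum mulr_suml.
by apply: eq_bigr => i _; rewrite family_sum_mull.
Qed.

(** Gram-Schmidt step.  If [u z u = u] and [s] is the sum of the family, then
    [(1 - s) z u] is a minimal idempotent orthogonal to the family, and it fixes
    [u] on the right. *)
Lemma family_extend n e u : orthogonal_family n e -> rank_one u ->
  u * family_sum n e = 0 ->
  exists e' : nat -> A,
    [/\ orthogonal_family n.+1 e', family_sum n.+1 e' = family_sum n e + e' n,
        u * e' n = u & exists w, e' n = (1 - family_sum n e) * w * u].
Proof.
set s := family_sum n e => fe u1 us.
have [z uzu] := rank_one_regular u1.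
pose f := (1 - s) * z * u.
have us1 : u * (1 - s) = u by rewrite mulrBr mulr1 us subr0.
have uf : u * f = u by rewrite /f !mulrA us1.
have sf : s * f = 0.
  by rewrite /f !mulrA mulrBr mulr1 family_sum_idem // subrr !mul0r.
have fs : f * s = 0 by rewrite /f -mulrA us mulr0.
have ff : f * f = f by rewrite {1}/f -mulrA uf.
have f1 : rank_one f.
  rewrite /f; apply: rank_one_mull => //; apply/eqP => f0.
  by have [/eqP[]] := u1; rewrite -uf /f f0 mulr0.
have fei i : (i < n)%N -> f * e i = 0.
  by move=> ilt; rewrite -(family_sum_mulr fe ilt) mulrA fs mul0r.
have eif i : (i < n)%N -> e i * f = 0.
  by move=> ilt; rewrite -(family_sum_mull fe ilt) -mulrA sf mulr0.
exists (fun i => if i == n then f else e i); rewrite eqxx; split=> //.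
- case: fe => [e1 eo]; split=> [i|i j].
    by rewrite ltnS leq_eqVlt; case: eqP => //= _; exact: e1.
  rewrite !ltnS (leq_eqVlt i) (leq_eqVlt j).
  case: (eqVneq i n) => [->|/= ni]; case: (eqVneq j n) => [->|/= nj] //=.
  + by move=> _ jlt; rewrite mulr0n fei.
  + by move=> ilt _; rewrite ?(negPf ni) mulr0n eif.
  + exact: eo.
- rewrite /family_sum big_ord_recr /= eqxx; congr (_ + _).
  by apply: eq_bigr => i _; rewrite ltn_eqF.
- by exists z.
Qed.

(** Orthogonalization of the summands [u] one by one: [family_extend] is applied
    to the part [u (1 - s)] not yet fixed by [s]. *)
Lemma socle_family (s : seq A) : (forall u, u \in s -> rank_one u) ->
  exists n e, orthogonal_family n e /\
    forall u, u \in s -> u * family_sum n e = u.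
Proof.
elim: s => [|u s IH] s1.
  by exists 0%N, (fun=> 0).
have [|n [e [fe se]]] := IH; first by move=> v vs; apply: s1; rewrite inE vs orbT.
set q := family_sum n e in se.
have qq : q * q = q by exact: family_sum_idem.
have [uq|/eqP uq] := eqVneq (u - u * q) 0.
  exists n, e; split=> // v; rewrite inE => /orP [/eqP ->|/se //].
  by move/eqP: uq; rewrite subr_eq0 eq_sym => /eqP.
pose v := u * (1 - q).
have v1 : rank_one v.
  apply: rank_one_mulr; first by apply: s1; rewrite mem_head.
  by rewrite mulrBr mulr1; apply/eqP.
have [|e' [fe' qe' ve' [w e'w]]] := @family_extend n e v fe v1.
  by rewrite /v -mulrA mulrBl mul1r qq subrr mulr0.
have qf : q * e' n = 0.
  have q1 : q * (1 - q) = 0 by rewrite mulrBr mulr1 qq subrr.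
  by rewrite e'w !mulrA q1 !mul0r.
exists n.+1, e'; split=> // x; rewrite qe' -/q mulrDr inE.
move=> /orP [/eqP ->|/se xq].
  rewrite -[in X in _ + X](subrK (u * q) u) mulrDl -mulrA qf mulr0 addr0.
  by rewrite -[X in X - _]mulr1 -mulrBr -/v ve' /v mulrBr mulr1 addrC subrK.
by rewrite -{2}xq -mulrA qf mulr0 addr0.
Qed.
End Socle.

(** * Matrix coordinates from minimal idempotents *)

Section Coordinates.
Variables (R : realType) (A : banachAlgType R[i]).
Hypothesis ssA : semisimple A.
Implicit Types (a c u x y : A) (e : nat -> A) (n : nat).

(** Coordinates of [s x s], where [s] is the sum of the family.  The minimal
    idempotents may belong to several simple components of the socle, and then
    [Phi] is not surjective. *)
Record matrix_rep n e (Phi : {linear A -> 'M[R[i]]_n}) : Prop := MatrixRep {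
  rep1 : Phi 1 = 1%:M;
  repM : forall x y, Phi (x * family_sum n e * y) = Phi x *m Phi y;
  rep_diag : forall (i : 'I_n) x, e i * x * e i = Phi x i i *: e i;
  rep_inj : forall x, Phi x = 0 -> family_sum n e * x * family_sum n e = 0;
  rep_bound : forall i j, exists k, forall x, `|Phi x i j| <= k * `|x| }.

(** Two minimal idempotents are linked when they lie in the same simple
    component, that is, when they generate isomorphic left ideals. *)
Definition linked e (i j : nat) := exists x, e i * x * e j != 0.

Lemma linked_refl n e i : orthogonal_family n e -> (i < n)%N -> linked e i i.
Proof.
move=> [e1 eo] ilt; exists 1; rewrite mulr1 eo // eqxx.
by have [] := e1 i ilt.
Qed.

Lemma linked_sym e i j : linked e i j -> linked e j i.
Proof.
move=> [x exe]; have [y H] := semiprime ssA exe; exists y.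
apply: contra_neq H => H.
by rewrite -!mulrA (mulrA (e j) y) (mulrA _ (e i)) H mul0r !mulr0.
Qed.

Lemma linked_trans n e i j k : orthogonal_family n e -> (j < n)%N ->
  linked e i j -> linked e j k -> linked e i k.
Proof.
move=> [e1 _] jlt [x exe] [z eze].
have [y H] := semiprime ssA exe.
have [_ /(_ (y * e i * x)) [l jl]] := e1 j jlt.
have l0 : l != 0.
  apply: contra_neq H => l0.
  have -> : e i * x * e j * y * (e i * x * e j) =
    e i * x * (e j * (y * e i * x) * e j) by rewrite !mulrA.
  by rewrite jl l0 scale0r mulr0.
exists (x * e j * z); apply/eqP => H0.
have : e j * (y * e i * x) * e j * z * e k = 0.
  transitivity (e j * y * (e i * (x * e j * z) * e k)); first by rewrite !mulrA.
  by rewrite H0 mulr0.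
rewrite jl -!scalerAl => /eqP; rewrite scaler_eq0 (negPf l0) /=.
by apply/negP.
Qed.

(** The elements [s] and [t] are matrix units between [e i] and [e j]. *)
Lemma linked_unit n e i j : orthogonal_family n e -> (i < n)%N -> (j < n)%N ->
  linked e i j -> exists s t,
    [/\ s * t = e i, t * s = e j, t * e i = t & e i * s = s /\ e j * t = t].
Proof.
move=> [e1 eo] ilt jlt [x exe]; have [y H] := semiprime ssA exe.
have ii : e i * e i = e i by rewrite eo // eqxx.
have jj : e j * e j = e j by rewrite eo // eqxx.
have [ei0 /(_ (x * e j * y)) [l il]] := e1 i ilt.
have [ej0 /(_ (y * e i * x)) [m jm]] := e1 j jlt.
have Hl : e i * x * e j * y * (e i * x * e j) = l *: (e i * x * e j).
  transitivity (e i * (x * e j * y) * e i * (x * e j)); first by rewrite !mulrA.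
  by rewrite il -scalerAl mulrA.
have Hm : e i * x * e j * y * (e i * x * e j) = m *: (e i * x * e j).
  transitivity (e i * x * (e j * (y * e i * x) * e j)); first by rewrite !mulrA.
  by rewrite jm -scalerAr.
have lm : l = m.
  apply/eqP; rewrite -subr_eq0; move/eqP: Hl; rewrite Hm -subr_eq0 -scalerBl.
  by rewrite scaler_eq0 (negPf exe) orbF -opprB oppr_eq0.
have l0 : l != 0 by apply: contra_neq H => l0; rewrite Hl l0 scale0r.
exists (e i * x * e j), (l^-1 *: (e j * y * e i)); split.
- rewrite -scalerAr; have -> : e i * x * e j * (e j * y * e i) =
    e i * (x * (e j * e j) * y) * e i by rewrite !mulrA.
  by rewrite jj il scalerA mulVf // scale1r.
- rewrite -scalerAl; have -> : e j * y * e i * (e i * x * e j) =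
    e j * (y * (e i * e i) * x) * e j by rewrite !mulrA.
  by rewrite ii jm -lm scalerA mulVf // scale1r.
- by rewrite -scalerAl -(mulrA _ (e i) (e i)) ii.
- split; first by rewrite !mulrA ii.
  by rewrite -scalerAr !mulrA jj.
Qed.

(** In every class of linked idempotents one member [g] is selected, and each
    [e i] of the class is factored as [s i * t i] with [t i * s i = g].  Since
    [g A g] is one-dimensional, [t i * x * s j] is a scalar multiple of [g], and
    this scalar is the entry of [Phi x]; it is 0 when [i] and [j] are in
    different classes. *)
Lemma matrix_rep_exists n e : orthogonal_family n e ->
  exists Phi : {linear A -> 'M[R[i]]_n}, matrix_rep e Phi.
Proof.
move=> fe; have [e1 eo] := fe.
pose P (i : 'I_n) := fun j : 'I_n => `[<linked e i j>].
pose r (i : 'I_n) : 'I_n := choose (P i) i.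
have Pii i : P i i by apply/asboolP; apply: linked_refl fe _.
have rP (i : 'I_n) : linked e i (r i) by apply/asboolP; exact: (chooseP (Pii i)).
have rE (i j : 'I_n) : linked e i j -> r i = r j.
  move=> ij; rewrite /r.
  have PE : P i =1 P j.
    move=> k; apply/asboolP/asboolP; apply: (linked_trans fe) => //.
    exact: linked_sym.
  by rewrite -(eq_choose PE); apply: choose_id => //; rewrite PE.
have /choice [f fP] : forall i : 'I_n, exists p : A * A,
    [/\ p.1 * p.2 = e i, p.2 * p.1 = e (r i), p.2 * e i = p.2 &
        e i * p.1 = p.1 /\ e (r i) * p.2 = p.2].
  move=> i; have [s [t H]] := linked_unit fe (ltn_ord i) (ltn_ord (r i)) (rP i).
  by exists (s, t).
pose s i := (f i).1; pose t i := (f i).2; pose g i := e (r i).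
have stE (i : 'I_n) : s i * t i = e i by have [] := fP i.
have tsE i : t i * s i = g i by have [] := fP i.
have tE i : t i * e i = t i by have [] := fP i.
have sE (i : 'I_n) : e i * s i = s i by have [_ _ _ []] := fP i.
have gt i : g i * t i = t i by have [_ _ _ []] := fP i.
have gg i : g i * g i = g i by rewrite eo // eqxx.
have sg i : s i * g i = s i by rewrite -tsE mulrA stE sE.
have g0 i : g i != 0 by have [] := e1 (r i) (ltn_ord _).
have txs0 i j x : t i * x * s j != 0 -> r i = r j.
  move=> txs; apply: rE; exists x; apply: contra_neq txs => H.
  by rewrite -tE -sE -!mulrA (mulrA x) (mulrA (e i)) (mulrA (e i)) H mul0r mulr0.
have ex i j x : exists l, t i * x * s j = l *: g i.
  have [->|/txs0 rij] := eqVneq (t i * x * s j) 0; first by exists 0; rewrite scale0r.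
  have [_ /(_ (t i * x * s j)) [l gl]] := e1 (r i) (ltn_ord _).
  exists l; rewrite -gl -/(g i) !mulrA gt -!mulrA.
  by rewrite /g rij -/(g j) sg.
pose phi i j x := xget 0 [set l | t i * x * s j = l *: g i].
have phiP i j x : t i * x * s j = phi i j x *: g i.
  by have := xgetPex 0 (ex i j x).
have phiE i j x l : t i * x * s j = l *: g i -> phi i j x = l.
  rewrite phiP => /eqP; rewrite -subr_eq0 -scalerBl scaler_eq0 (negPf (g0 i)) orbF.
  by rewrite subr_eq0 => /eqP.
pose Phi0 x := \matrix_(i, j) phi i j x.
have lin : linear Phi0.
  move=> k x y; apply/matrixP => i j; rewrite !mxE; apply: (phiE).
  by rewrite mulrDr mulrDl -scalerAr -scalerAl !phiP scalerDl scalerA.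
pose Phi : {linear A -> 'M[R[i]]_n} :=
  HB.pack Phi0 (GRing.isLinear.Build _ _ _ _ Phi0 lin).
have PhiE x i j : Phi x i j = phi i j x by rewrite /= mxE.
have delta i j : t i * s j = g i *+ (i == j).
  have [->|ij] := eqVneq i j; first by rewrite tsE.
  by rewrite -tE -sE -mulrA (mulrA (e i)) eo // val_eqE (negPf ij) mulr0n mul0r mulr0.
exists Phi; split.
- apply/matrixP => i j; rewrite PhiE mxE; apply: (phiE).
  by rewrite mulr1 delta scaler_nat.
- move=> x y; apply/matrixP => i j; rewrite PhiE mxE; apply: (phiE).
  have -> : t i * (x * family_sum n e * y) * s j =
      \sum_(k < n) (t i * x * s k) * (t k * y * s j).
    rewrite /family_sum mulr_sumr mulr_suml mulr_sumr mulr_suml.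
    by apply: eq_bigr => k _; rewrite -stE !mulrA.
  rewrite scaler_suml; apply: eq_bigr => k _; rewrite !PhiE.
  have [txs|txs] := eqVneq (t i * x * s k) 0.
    by rewrite txs mul0r (phiE _ _ _ 0) ?scale0r // mul0r scale0r.
  rewrite !phiP -scalerAl -scalerAr scalerA /g (txs0 _ _ _ txs) -/(g k).
  by rewrite gg.
- move=> i x; rewrite PhiE -{1 2}stE -!mulrA (mulrA (t i)) (mulrA _ (s i)) phiP.
  by rewrite -scalerAl -scalerAr gt stE.
- move=> x Phi0x; rewrite /family_sum mulr_suml mulr_suml big1 // => i _.
  rewrite mulr_sumr big1 // => j _.
  have : Phi x i j = 0 by rewrite Phi0x mxE.
  rewrite PhiE => phi0; rewrite -(stE i) -(stE j) -!mulrA (mulrA (t i)) (mulrA _ (s j)).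
  by rewrite phiP phi0 scale0r mul0r mulr0.
- move=> i j; exists (`|t i| * `|s j| / `|g i|) => x.
  rewrite PhiE mulrAC ler_pdivlMr ?normr_gt0 // -normrZ -phiP.
  apply: le_trans (normrM_le _ _) _.
  by rewrite mulrAC ler_wpM2r // normrM_le.
Qed.
End Coordinates.

(** * Spectrum and characteristic polynomial *)

Section SpectrumRoots.
Variables (R : realType) (A : banachAlgType R[i]).
Implicit Types (a c u x y : A) (e : nat -> A) (n : nat) (mu : R[i]).

(** [P(mu) - P(c)] is a multiple of [mu - c]. *)
Lemma not_spectrum_annihilated c mu (P : {poly R[i]}) :
  horner_alg c P = 0 -> P.[mu] != 0 -> ~ spectrum c mu.
Proof.
move=> Pc Pmu; suff : invertible (mu%:A - c) by move=> ? [].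
have /factor_theorem [q Pq] : root (P - P.[mu]%:P) mu.
  by rewrite /root !hornerE subrr.
have E1 : horner_alg c q * (mu%:A - c) = P.[mu]%:A.
  have := congr1 (horner_alg c) Pq.
  rewrite !rmorphB rmorphM rmorphB /= Pc horner_algC horner_algX horner_algC.
  by rewrite sub0r => /eqP; rewrite -eqr_opp opprK -mulrN opprB => /eqP.
have E2 : (mu%:A - c) * horner_alg c q = P.[mu]%:A.
  rewrite -E1 mulrBl mulrBr mulr_algl mulr_algr; congr (_ - _).
  by rewrite -{1 4}(horner_algX c) -!rmorphM mulrC.
exists (P.[mu]^-1 *: horner_alg c q).
by rewrite -scalerAl -scalerAr E1 E2 scalerA mulVf // scale1r.
Qed.

Lemma repMl n e (Phi : {linear A -> 'M[R[i]]_n}) c x :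
  matrix_rep e Phi -> c * family_sum n e = c ->
  Phi (c * x) = Phi c *m Phi x.
Proof. by move=> rPhi cs; rewrite -{1}cs (repM rPhi). Qed.

Lemma horner_algMX c q : horner_alg c q * c = c * horner_alg c q.
Proof. by rewrite -{2 3}(horner_algX c) -!rmorphM mulrC. Qed.

Lemma rep_horner n e (Phi : {linear A -> 'M[R[i]]_n.+1}) c q :
  matrix_rep e Phi -> c * family_sum n.+1 e = c ->
  Phi (horner_alg c q) = horner_mx (Phi c) q.
Proof.
move=> rPhi cs; elim/poly_ind: q => [|q l IH]; first by rewrite !rmorph0 linear0.
rewrite !rmorphD !rmorphM /= linearD horner_algX horner_mx_X horner_algMX.
rewrite (repMl _ rPhi cs) IH horner_algC horner_mx_C linearZ /= (rep1 rPhi).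
rewrite scalemx1; congr (_ + _).
rewrite -[X in X *m _](horner_mx_X (Phi c)) -[X in _ = _ * X](horner_mx_X (Phi c)).
by rewrite -rmorphM /= mulrC rmorphM.
Qed.

(** Cayley-Hamilton, transported through the injectivity of [Phi] on [s A s]. *)
Lemma rep_char_poly n e (Phi : {linear A -> 'M[R[i]]_n}) c :
  matrix_rep e Phi -> c * family_sum n e = c ->
  family_sum n e * horner_alg c (char_poly (Phi c)) * family_sum n e = 0.
Proof.
case: n Phi => [|n] Phi rPhi cs; first by rewrite /family_sum big_ord0 mulr0.
apply: (rep_inj rPhi); rewrite (rep_horner _ rPhi cs).
exact: Cayley_Hamilton.
Qed.

Lemma rep_annihilator n e (Phi : {linear A -> 'M[R[i]]_n}) c :
  matrix_rep e Phi -> c * family_sum n e = c ->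
  horner_alg c ('X * char_poly (Phi c)) = 0.
Proof.
move=> rPhi cs; rewrite rmorphM /= horner_algX -horner_algMX.
have H := rep_char_poly rPhi cs; set X := horner_alg c _ in H *.
transitivity (c * (family_sum n e * X * family_sum n e)); last by rewrite H mulr0.
by rewrite !mulrA cs -horner_algMX -mulrA cs.
Qed.

Lemma root_spectrum n e (Phi : {linear A -> 'M[R[i]]_n}) c mu :
  matrix_rep e Phi -> c * family_sum n e = c ->
  root (char_poly (Phi c)) mu -> spectrum c mu.
Proof.
move=> rPhi cs rmu [y [_ cy]].
pose N := mu%:M - Phi c.
have yN : N *m Phi y = 1%:M.
  rewrite -(rep1 rPhi) -cy mulrBl mulr_algl linearB linearZ /= (repMl _ rPhi cs).
  by rewrite mulmxBl mul_scalar_mx.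
have /eigenvalueP [v vmu v0] : eigenvalue (Phi c) mu.
  by rewrite eigenvalue_root_char.
move/eqP: v0; apply; rewrite -[v]mulmx1 -yN mulmxA /N mulmxBr vmu mul_mx_scalar.
by rewrite subrr mul0mx.
Qed.

(** The factor ['X] in the annihilator adds 0 to its roots, whence the exception
    unless [s = 1], in which case the characteristic polynomial itself kills
    [c]. *)
Lemma spectrum_root n e (Phi : {linear A -> 'M[R[i]]_n}) c mu :
  matrix_rep e Phi -> c * family_sum n e = c ->
  mu != 0 \/ family_sum n e = 1 ->
  spectrum c mu -> root (char_poly (Phi c)) mu.
Proof.
move=> rPhi cs mu1; apply: contraPT => nr; case: mu1 => [mu0|s1].
  apply: not_spectrum_annihilated (rep_annihilator rPhi cs) _.
  by rewrite hornerM hornerX mulf_neq0.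
have := rep_char_poly rPhi cs; rewrite s1 mul1r mulr1.
by move=> /not_spectrum_annihilated; apply.
Qed.
End SpectrumRoots.

(** * The support of an element of the socle *)

Section Support.
Variables (R : realType) (A : banachAlgType R[i]).
Hypothesis ssA : semisimple A.
Implicit Types (a c u x y : A) (e : nat -> A) (n : nat).

(** The diagonal matrix with distinct nonzero entries 1, ..., n. *)
Definition family_diag n e : A := \sum_(i < n) i.+1%:R *: e i.

Lemma family_diagM n e i : orthogonal_family n e -> (i < n)%N ->
  family_diag n e * e i = i.+1%:R *: e i.
Proof.
move=> [_ orth] ilt; rewrite /family_diag mulr_suml (bigD1 (Ordinal ilt)) //=.
rewrite -scalerAl orth // eqxx big1 ?addr0 // => j.
by rewrite -val_eqE /= -scalerAl orth // => /negPf ->; rewrite scaler0.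
Qed.

Lemma family_diag_mull n e : orthogonal_family n e ->
  family_diag n e * family_sum n e = family_diag n e.
Proof.
move=> fe; rewrite /family_diag mulr_suml; apply: eq_bigr => i _.
by rewrite -scalerAl family_sum_mull.
Qed.

Lemma family_diag_spectrum n e i : orthogonal_family n e -> (i < n)%N ->
  spectrum (family_diag n e) (i.+1%:R).
Proof.
move=> fe ilt [y [yd _]]; have [e1 _] := fe; have [/eqP[]] := e1 i ilt.
rewrite -[e i]mul1r -yd -mulrA mulrBl mulr_algl family_diagM //.
by rewrite subrr mulr0.
Qed.

(** The elements 1, ..., n of the spectrum of [family_diag n e] are roots of a
    characteristic polynomial of degree [m]. *)
Lemma family_size_le m e0 n e y a :
  orthogonal_family m e0 -> a * family_sum m e0 = a ->
  orthogonal_family n e -> family_sum n e = y * a -> (n <= m)%N.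
Proof.
move=> fe0 as0 fe sy; have [Phi rPhi] := matrix_rep_exists ssA fe0.
pose d := family_diag n e.
have ds : d * family_sum m e0 = d.
  by rewrite /d -(family_diag_mull fe) sy -!mulrA as0.
pose rs := [seq (i.+1%:R : R[i]) | i <- iota 0 n].
have urs : uniq rs.
  rewrite map_inj_uniq ?iota_uniq // => i j /eqP.
  by rewrite eqr_nat => /eqP [].
have ars : all (root (char_poly (Phi d))) rs.
  apply/allP => _ /mapP [k kn ->]; move: kn; rewrite mem_iota add0n /= => klt.
  apply: (spectrum_root rPhi ds); first by left; rewrite pnatr_eq0.
  exact: family_diag_spectrum.
have := max_poly_roots _ ars urs.
rewrite size_map size_iota size_char_poly ltnS; apply.
by rewrite monic_neq0 // char_poly_monic.
Qed.

(** A family of maximal size among those whose sum [s] is in [A a]; the size is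
    bounded by [family_size_le].  If [c = a - a s] were nonzero, semiprimeness
    would give a rank one element in [A c], and [family_extend] a larger
    family. *)
Lemma socle_support a : socle a -> exists n e,
  [/\ orthogonal_family n e, a * family_sum n e = a &
      exists y, family_sum n e = y * a].
Proof.
move=> [l [l1 al]]; have [m [e0 [fe0 le0]]] := socle_family ssA l1.
have as0 : a * family_sum m e0 = a.
  by rewrite al mulr_suml; apply: eq_big_seq => u /le0.
pose P k := `[<exists e, orthogonal_family k e /\
  exists y, family_sum k e = y * a>].
have P0 : exists k, P k.
  exists 0%N; apply/asboolP; exists (fun=> 0); split=> //.
  by exists 0; rewrite /family_sum big_ord0 mul0r.
have Pm k : P k -> (k <= m)%N.
  by move=> /asboolP [e [fe [y sy]]]; exact: family_size_le fe0 as0 fe sy.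
(* Here [P k] says that some family of size [k] has its sum in [A a]. *)
case: (ex_maxnP P0 Pm) => n /asboolP [e [fe [y0 sy]]] maxn.
exists n, e; split=> //; last by exists y0.
set s := family_sum n e in sy *.
have ss : s * s = s by exact: family_sum_idem.
apply/eqP; rewrite eq_sym -subr_eq0; apply: contraT => c0.
set c := a - a * s in c0.
have [y cyc] := semiprime ssA c0.
have cs : c * s = 0 by rewrite mulrBl -mulrA ss subrr.
have cE : c = \sum_(u <- l) u * (1 - s).
  by rewrite -mulr_suml -al mulrBr mulr1.
have [u ul v0] : exists2 u, u \in l & u * ((1 - s) * y * c) != 0.
  apply: contrapT => H; move/eqP: cyc; apply.
  rewrite {1}cE !mulr_suml big_seq big1 // => u ul; apply: contrapT => /eqP v0.
  by apply: H; exists u; rewrite // !mulrA.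
have v1 := rank_one_mulr (l1 u ul) v0; set v := u * _ in v1.
have vs : v * s = 0 by rewrite /v -!mulrA cs !mulr0.
have [e' [fe' se' _ [w e'w]]] := family_extend ssA fe v1 vs.
suff /maxn : P n.+1 by rewrite ltnn.
apply/asboolP; exists e'; split=> //.
exists (y0 + (1 - s) * w * u * ((1 - s) * y) * (1 - a * y0)).
have cE2 : c = (1 - a * y0) * a by rewrite /c sy mulrBl mul1r mulrA.
by rewrite se' -/s e'w -/s /v cE2 [RHS]mulrDl -sy !mulrA.
Qed.
End Support.

(** * Counting measure and disks *)

Lemma countingE (R : realType) (T : choiceType) (s : seq T) (X : set T) :
  (forall x, X x <-> x \in s) ->
  counting X = (size (undup s))%:R%:E :> \bar R.
Proof.
move=> XE; have -> : X = [set` s] by apply/seteqP; split=> x /XE.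
have fs := finite_seq s; rewrite /counting asboolT //; congr (_%:R%:E).
apply: perm_size; apply: uniq_perm; rewrite ?undup_uniq ?finmap.fset_uniq //.
by move=> x; rewrite in_fset_set // mem_undup; apply/idP/idP; rewrite inE.
Qed.

(** A point at distance exactly [r] is approached from inside the disk by moving
    it slightly towards the center. *)
Lemma closure_ball_le (K : numFieldType) (c z : K) (r : K) : 0 < r ->
  closure (ball (c : K^o) r) z <-> `|c - z| <= r.
Proof.
move=> r0; split=> [clz|le_r B /nbhs_ballP [d d0 dB]].
  rewrite real_leNgt ?normr_real ?gtr0_real //; apply/negP => lt_r.
  have d0 : 0 < `|c - z| - r by rewrite subr_gt0.
  have [w []] := clz _ (nbhsx_ballx (z : K^o) _ d0).
  rewrite -ball_normE /= => cw zw.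
  have : `|c - z| < `|c - z|.
    rewrite -{1}(subrKA w) (le_lt_trans (ler_normD _ _)) //.
    by rewrite -[ltRHS](subrKC r) ltrD // distrC.
  by rewrite ltxx.
pose t := d / (d + r).
have dr : 0 < d + r by exact: addr_gt0.
have t0 : 0 < t by exact: divr_gt0.
have t1 : 0 < 1 - t by rewrite subr_gt0 ltr_pdivrMr // mul1r ltrDl.
exists (z + t * (c - z)); split; last apply: dB; rewrite -ball_normE /=.
  have -> : c - (z + t * (c - z)) = (1 - t) * (c - z).
    by rewrite mulrBl mul1r opprD addrA.
  rewrite normrM gtr0_norm // (@le_lt_trans _ _ ((1 - t) * r)) ?ler_pM2l //.
  by rewrite gtr_pMl // ltrBlDr ltrDl.
rewrite opprD addrA subrr sub0r normrN normrM gtr0_norm //.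
rewrite (@le_lt_trans _ _ (t * r)) ?ler_pM2l // /t mulrAC ltr_pdivrMr //.
by rewrite ltr_pM2l // ltrDr.
Qed.

(** Half of the harmonic mean of two radii serves as a bound below both of them,
    which avoids minima in a partially ordered field. *)
Lemma isolating_radius (K : numFieldType) (c : K) (s : seq K) :
  exists2 r : K, 0 < r & forall z, z \in s -> z != c -> r < `|c - z|.
Proof.
elim: s => [|w s [r r0 rs]]; first by exists 1.
have [->|wc] := eqVneq w c.
  by exists r => // z; rewrite inE => /orP [/eqP ->|/rs //]; rewrite eqxx.
have d0 : 0 < `|c - w| by rewrite normr_gt0 subr_eq0 eq_sym.
pose d := `|c - w|; exists (d * r / (d + r)).
  by rewrite divr_gt0 ?mulr_gt0 ?addr_gt0.
have dr : 0 < d + r by exact: addr_gt0.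
move=> z; rewrite inE => /orP [/eqP -> _|zs zc].
  by rewrite ltr_pdivrMr // ltr_pM2l // ltrDr.
apply: lt_trans (rs z zs zc).
by rewrite ltr_pdivrMr // mulrC ltr_pM2l // ltrDl.
Qed.

(** * Multiplicities are algebraic multiplicities *)

Section Multiplicity.
Variables (R : realType) (A : banachAlgType R[i]).
Variables (a y : A) (n : nat) (e : nat -> A) (Phi : {linear A -> 'M[R[i]]_n}).
Hypothesis fe : orthogonal_family n e.
Hypothesis rPhi : matrix_rep e Phi.
Local Notation s := (family_sum n e).
Hypothesis as_a : a * s = a.
Hypothesis sy : s = y * a.
Implicit Types (x : A) (z mu : R[i]) (rs : seq R[i]).

Let xas x : x * a * s = x * a. Proof. by rewrite -mulrA as_a. Qed.

Lemma char_poly_roots x :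
  exists2 rs, char_poly (Phi (x * a)) = \prod_(z <- rs) ('X - z%:P) & size rs = n.
Proof.
have [rs Ers srs] := monic_factor (char_poly_monic (Phi (x * a))).
by exists rs; rewrite // srs size_char_poly.
Qed.

Lemma nonzero_spectrum_roots x rs :
  char_poly (Phi (x * a)) = \prod_(z <- rs) ('X - z%:P) ->
  forall z, nonzero_spectrum (x * a) z <-> z \in [seq z <- rs | z != 0].
Proof.
move=> Ers z; rewrite mem_filter -root_prod_XsubC -Ers; split.
  move=> [sz /eqP z0]; rewrite z0; apply: spectrum_root rPhi (xas x) _ sz.
  by left.
by move=> /andP [/eqP z0 rz]; split=> //; exact: root_spectrum rPhi (xas x) rz.
Qed.

Lemma counting_nonzero_spectrum x rs :
  char_poly (Phi (x * a)) = \prod_(z <- rs) ('X - z%:P) ->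
  counting (nonzero_spectrum (x * a)) =
    (size (undup [seq z <- rs | z != 0]))%:R%:E :> \bar R.
Proof. by move=> Ers; apply: countingE; exact: nonzero_spectrum_roots. Qed.

Lemma counting_nonzero_spectrum_le x :
  (counting (nonzero_spectrum (x * a)%R) <= n%:R%:E :> \bar R)%E.
Proof.
have [rs Ers srs] := char_poly_roots x.
rewrite (counting_nonzero_spectrum Ers) lee_fin ler_nat -srs.
by rewrite (leq_trans (size_undup _)) // size_filter count_size.
Qed.

(** The bound of [counting_nonzero_spectrum_le] is attained at [x] with
    [x a = family_diag n e]; such an [x] exists because [s = y a]. *)
Lemma counting_nonzero_spectrum_diag :
  (n%:R%:E <= counting (nonzero_spectrum (family_diag n e * y * a)%R) :> \bar R)%E.
Proof.
have [rs Ers srs] := char_poly_roots (family_diag n e * y).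
rewrite (counting_nonzero_spectrum Ers) lee_fin ler_nat.
pose ks := [seq (k.+1%:R : R[i]) | k <- iota 0 n].
have <- : size ks = n by rewrite size_map size_iota.
apply: uniq_leq_size.
  rewrite map_inj_uniq ?iota_uniq // => i j /eqP.
  by rewrite eqr_nat => /eqP [].
move=> _ /mapP [k kn ->]; move: kn; rewrite mem_iota add0n /= => kn.
rewrite mem_undup; apply/(nonzero_spectrum_roots Ers); split.
  by rewrite -mulrA -sy family_diag_mull //; exact: family_diag_spectrum.
by apply/eqP; rewrite pnatr_eq0.
Qed.

Lemma rank_support : rank a = n%:R%:E.
Proof.
apply/eqP; rewrite eq_le; apply/andP; split.
  by apply/ereal_supP => _ [x _ <-]; exact: counting_nonzero_spectrum_le.
apply: le_trans counting_nonzero_spectrum_diag _.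
by apply: ereal_sup_ubound; exists (family_diag n e * y).
Qed.

Lemma rank_attained_roots x rs :
  char_poly (Phi (x * a)) = \prod_(z <- rs) ('X - z%:P) ->
  rank_attained a x <-> uniq rs /\ 0 \notin rs.
Proof.
move=> Ers.
have srs : size rs = n.
  by have := size_char_poly (Phi (x * a)); rewrite Ers size_prod_XsubC => -[].
rewrite /rank_attained /= (counting_nonzero_spectrum Ers) rank_support -srs; split.
  move=> [/eqP]; rewrite eqr_nat => /eqP szE.
  have szf : size [seq z <- rs | z != 0] = size rs.
    apply/eqP; rewrite eqn_leq {1}size_filter count_size -{1}szE.
    exact: size_undup.
  have fE : [seq z <- rs | z != 0] = rs.
    by apply/all_filterP; rewrite all_count -size_filter szf.
  rewrite fE in szE; split; first by rewrite -[uniq _]negbK -ltn_size_undup szE ltnn.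
  by rewrite -fE mem_filter eqxx.
move=> [urs n0]; have -> : [seq z <- rs | z != 0] = rs.
  by apply/all_filterP/allP => z zrs; apply: contraNneq n0 => <-.
by rewrite undup_id.
Qed.

Lemma rank_attained_separable x :
  rank_attained a x <-> separable_poly (char_poly (Phi (x * a))) /\
    ~~ root (char_poly (Phi (x * a))) 0.
Proof.
have [rs Ers _] := char_poly_roots x.
by rewrite (rank_attained_roots Ers) Ers separable_prod_XsubC root_prod_XsubC.
Qed.

(** On the line from 1 to a point where the rank is attained, it is attained off
    the zeros of a nonzero polynomial. *)
Lemma rank_attained_dense (d : R[i]) : 0 < d ->
  exists2 x, rank_attained a x & ball (1 : A) d x.
Proof.
move=> d0; pose x0 := family_diag n e * y.
have : rank_attained a x0.
  rewrite /rank_attained /= rank_support; apply/eqP; rewrite eq_le.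
  by rewrite counting_nonzero_spectrum_le counting_nonzero_spectrum_diag.
pose x t := 1 + t *: (x0 - 1).
have xE t : Phi (x t * a) = Phi a + t *: Phi ((x0 - 1) * a).
  by rewrite /x mulrDl mul1r -scalerAl linearD linearZ.
have x1 : x 1 = x0 by rewrite /x scale1r subrKC.
rewrite -x1 => /rank_attained_separable []; rewrite xE => sep nr.
have [D D0 DP] := line_char_poly sep nr.
have k0 : 0 < 1 + `|x0 - 1| by rewrite ltr_wpDr.
have [t tlt Dt] := nonroot_small D0 (divr_gt0 d0 k0).
exists (x t); first by apply/rank_attained_separable; rewrite xE; exact: DP.
rewrite -ball_normE /= /x opprD addrA subrr sub0r normrN normrZ.
move: tlt; rewrite ltr_pdivlMr // mulrDr mulr1; apply: le_lt_trans.
by rewrite lerDr.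
Qed.

Lemma rep_cvg i j :
  (fun x => Phi (x * a) i j : R[i]^o) @ nbhs (1 : A) --> (Phi a i j : R[i]^o).
Proof.
have [k0 bound] := rep_bound rPhi i j; pose k := `|k0| * `|a|.
have k1 : 0 < 1 + k by rewrite ltr_wpDr // mulr_ge0.
apply/cvgrPdist_lt => d d0; apply/nbhs_ballP.
exists (d / (1 + k)) => [|x]; first exact: divr_gt0.
rewrite -ball_normE /= ltr_pdivlMr // => xd.
have -> : Phi a i j - Phi (x * a) i j = Phi ((1 - x) * a) i j.
  by rewrite mulrBl mul1r linearB !mxE.
apply: le_lt_trans (bound _) _; apply: le_lt_trans xd.
rewrite mulrDr mulr1 (@le_trans _ _ (`|1 - x| * k)) ?lerDr //.
have k0r : k0 * `|(1 - x) * a| <= `|k0| * `|(1 - x) * a|.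
  rewrite -[leRHS]ger0_norm ?mulr_ge0 // normrM normr_id -normrM.
  apply: real_ler_norm.
  suff : 0 <= k0 * `|(1 - x) * a| by exact: ger0_real.
  exact: le_trans (bound _).
apply: le_trans k0r _; rewrite /k mulrCA ler_wpM2l //.
exact: normrM_le.
Qed.

Lemma spectrum_cap_ball x rs mu r :
  char_poly (Phi (x * a)) = \prod_(z <- rs) ('X - z%:P) ->
  s = 1 \/ ~ ball (mu : R[i]^o) r 0 ->
  counting (spectrum (x * a) `&` ball (mu : R[i]^o) r) =
    (size (undup [seq z <- rs | `|mu - z| < r]))%:R%:E :> \bar R.
Proof.
move=> Ers s1; apply: countingE => z; rewrite mem_filter -root_prod_XsubC -Ers.
rewrite -ball_normE /=; split=> [[sz zr]|/andP [zr rz]]; last first.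
  by split=> //; exact: root_spectrum rPhi (xas x) rz.
rewrite zr; apply: spectrum_root rPhi (xas x) _ sz.
case: s1 => [|nb]; first by right.
by left; apply/eqP => z0; apply: nb; rewrite -ball_normE /= -z0.
Qed.

Variable rs : seq R[i].
Hypothesis Ers : char_poly (Phi a) = \prod_(z <- rs) ('X - z%:P).

Let srs : size rs = n.
Proof. by have := size_char_poly (Phi a); rewrite Ers size_prod_XsubC => -[]. Qed.

Lemma root_count_cvg mu r : 0 < r ->
  (forall z, z \in rs -> z != mu -> r < `|mu - z|) ->
  \forall x \near (1 : A), exists rx,
    char_poly (Phi (x * a)) = \prod_(z <- rx) ('X - z%:P) /\
    count (fun z => `|mu - z| < r) rx = count_mem mu rs.
Proof.
move=> r0 rsr.
have [|||rx [srx Erx rx_cvg]] :=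
    @roots_cvg _ _ (nbhs (1 : A)) _ rs (fun x => char_poly (Phi (x * a))).
- by move=> x; exact: char_poly_monic.
- by move=> x; rewrite size_char_poly srs.
- rewrite -Ers; apply: coef_cvg_char_poly => i j; exact: rep_cvg.
(* Roots converging to [mu] end up in the disk, and the others, whose limits lie
   outside the closed disk, end up outside. *)
have : \forall x \near (1 : A), forall i : 'I_(size rs),
    (`|mu - (rx x)`_i| < r) = (rs`_i == mu).
  apply: filter_forall => i; have /cvgrPdist_lt ri := rx_cvg i (ltn_ord i).
  have [imu|imu] := eqVneq rs`_i mu.
    by have := ri _ r0; apply: filterS => x; rewrite imu.
  have ri_gt : r < `|mu - rs`_i| by apply: rsr => //; exact: mem_nth.
  have d0 : 0 < `|mu - rs`_i| - r by rewrite subr_gt0.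
  have := ri _ d0; apply: filterS => x xd.
  apply/negP => xr; have : `|mu - rs`_i| < `|mu - rs`_i|.
    rewrite -{1}(subrKA (rx x)`_i) (le_lt_trans (ler_normD _ _)) //.
    by rewrite -[ltRHS](subrKC r) ltrD // distrC.
  by rewrite ltxx.
apply: filterS => x xE; exists (rx x); split; first exact: Erx.
rewrite -!sum1_count [LHS](big_nth 0) [RHS](big_nth 0) srx !big_mkord.
by apply: eq_bigl => i; rewrite xE.
Qed.

Lemma spectrum_of_root z : z \in rs -> spectrum a z.
Proof.
move=> zrs; apply: root_spectrum rPhi as_a _.
by rewrite Ers root_prod_XsubC.
Qed.

(** If [a] is invertible then [a s = a] forces [s = 1]. *)
Lemma support_full : ~ spectrum a 0 -> s = 1.
Proof.
move=> /contrapT [w [wa _]]; rewrite scale0r sub0r in wa.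
by rewrite -[s]mul1r -wa -mulrA mulNr as_a.
Qed.

(** The spectrum of [x a] in the disk consists of the roots of the characteristic
    polynomial of [Phi (x a)] there; their number, counted with multiplicity, is
    constant for [x] near 1, and they are simple when [x] attains the rank.  The
    disk may contain 0 only when [a] is invertible, and then [s = 1]. *)
Lemma is_multiplicity_count mu : mu != 0 -> is_multiplicity mu a (count_mem mu rs).
Proof.
move=> mu0 r r0 isol.
have rsr z : z \in rs -> z != mu -> r < `|mu - z|.
  move=> zrs; rewrite real_ltNge ?normr_real ?gtr0_real //.
  apply: contraNN => /(closure_ball_le _ _ r0) clz; apply/eqP.
  by apply: isol; split=> //; exact: spectrum_of_root.
have s1 : s = 1 \/ ~ ball (mu : R[i]^o) r 0.
  have [sp0|nsp0] := pselect (spectrum a 0); last by left; exact: support_full.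
  right=> b0; move/eqP: mu0; apply; apply/esym; apply: isol; split=> //.
  exact: subset_closure.
have /nbhs_ballP [d d0 dP] := root_count_cvg r0 rsr.
exists d => // x /rank_attained_roots xE /dP [rx [Erx <-]].
have [urx _] := xE _ Erx.
rewrite (spectrum_cap_ball Erx s1) undup_id ?filter_uniq //.
by rewrite size_filter.
Qed.

(** Two candidate multiplicities are compared at a point near 1 where the rank is
    attained, which exists by [rank_attained_dense]. *)
Theorem multiplicity_count mu : mu != 0 -> multiplicity mu a = count_mem mu rs.
Proof.
move=> mu0; have Hm := is_multiplicity_count mu0.
have Hm' : is_multiplicity mu a (multiplicity mu a).
  by apply: (@xgetPex _ 0%N); exists (count_mem mu rs).
have [r r0 rsr] := isolating_radius mu (0 :: rs).
have isol : closure (ball (mu : R[i]^o) r) `&` spectrum a `<=` [set mu].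
  move=> z [/(closure_ball_le _ _ r0) zr sz]; apply: contrapT => /eqP zmu.
  suff /rsr/(_ zmu) : z \in 0 :: rs.
    by move=> /lt_le_trans /(_ zr); rewrite ltxx.
  rewrite inE; have [//|z0] := eqVneq z 0.
  rewrite -root_prod_XsubC -Ers; apply: spectrum_root rPhi as_a _ sz.
  by left.
have [d d0 dP] := Hm r r0 isol; have [d' d'0 dP'] := Hm' r r0 isol.
(* Half of the harmonic mean is smaller than both [d] and [d']. *)
have [x xE xd] := rank_attained_dense (divr_gt0 (mulr_gt0 d0 d'0) (addr_gt0 d0 d'0)).
have dd : 0 < d + d' by exact: addr_gt0.
have le1 : d * d' / (d + d') <= d.
  by rewrite ler_pdivrMr // ler_pM2l // lerDr ltW.
have le2 : d * d' / (d + d') <= d'.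
  by rewrite ler_pdivrMr // mulrC ler_pM2l // lerDl ltW.
have := dP x xE (le_ball le1 xd); rewrite (dP' x xE (le_ball le2 xd)).
by move=> [/eqP]; rewrite eqr_nat => /eqP.
Qed.

Lemma nonzero_spectrum_count mu :
  nonzero_spectrum a mu <-> mu != 0 /\ (0 < count_mem mu rs)%N.
Proof.
rewrite -has_count has_pred1 -root_prod_XsubC -Ers; split=> [[sm /eqP m0]|[m0 rm]].
  by split=> //; apply: spectrum_root rPhi as_a _ sm; left.
by split; [exact: root_spectrum rPhi as_a rm|exact/eqP].
Qed.
End Multiplicity.

(** * Traces of idempotents *)

Section Trace.
Variables (R : realType) (A : banachAlgType R[i]).
Implicit Types (a c p x y : A) (e : nat -> A) (n : nat).

(** Both sides are the scalar [d] in [X p X = d X] where [X = e_i p e'_j],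
    unless [X = 0], when both vanish. *)
Lemma rep_diag_swap n e (Phi : {linear A -> 'M[R[i]]_n}) m e'
    (Phi' : {linear A -> 'M[R[i]]_m}) p (i : 'I_n) (j : 'I_m) :
  orthogonal_family n e -> matrix_rep e Phi ->
  orthogonal_family m e' -> matrix_rep e' Phi' ->
  Phi (p * e' j * p) i i = Phi' (p * e i * p) j j.
Proof.
move=> [e1 _] rPhi [e1' _] rPhi'.
have [ei0 _] := e1 i (ltn_ord i); have [ej0 _] := e1' j (ltn_ord j).
have dE := rep_diag rPhi i (p * e' j * p).
have dE' := rep_diag rPhi' j (p * e i * p).
pose X := e i * p * e' j.
have [X0|X0] := eqVneq X 0.
  have /eqP : Phi (p * e' j * p) i i *: e i = 0.
    by rewrite -dE !mulrA -/X X0 !mul0r.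
  rewrite scaler_eq0 (negPf ei0) orbF => /eqP ->.
  have /eqP : Phi' (p * e i * p) j j *: e' j = 0.
    by rewrite -dE' -!mulrA (mulrA (e i)) -/X X0 !mulr0.
  by rewrite scaler_eq0 (negPf ej0) orbF => /eqP ->.
have H : Phi (p * e' j * p) i i *: X = Phi' (p * e i * p) j j *: X.
  transitivity (X * p * X).
    have {1}-> : X = e i * (p * e' j) by rewrite mulrA.
    by rewrite scalerAl -dE /X !mulrA.
  by rewrite {3}/X scalerAr -dE' /X !mulrA.
by apply/eqP; rewrite -subr_eq0; move/eqP: H;
  rewrite -subr_eq0 -scalerBl scaler_eq0 (negPf X0) orbF.
Qed.

(** [p] is the sum of the [p e'_j p] and also of the [p e_i p]; expanding each
    diagonal entry accordingly, the two traces become the same double sum by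
    [rep_diag_swap]. *)
Lemma rep_trace_indep n e (Phi : {linear A -> 'M[R[i]]_n}) m e'
    (Phi' : {linear A -> 'M[R[i]]_m}) p :
  orthogonal_family n e -> matrix_rep e Phi ->
  orthogonal_family m e' -> matrix_rep e' Phi' ->
  p * p = p -> p * family_sum n e = p -> p * family_sum m e' = p ->
  \tr (Phi p) = \tr (Phi' p).
Proof.
move=> fe rPhi fe' rPhi' pp pe pe'.
have E1 : p = \sum_(j < m) p * e' j * p.
  by rewrite -mulr_suml -mulr_sumr -/(family_sum m e') pe' pp.
have E2 : p = \sum_(i < n) p * e i * p.
  by rewrite -mulr_suml -mulr_sumr -/(family_sum n e) pe pp.
rewrite /mxtrace.
transitivity (\sum_(i < n) \sum_(j < m) Phi (p * e' j * p) i i).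
  by apply: eq_bigr => i _; rewrite {1}E1 linear_sum summxE.
rewrite exchange_big; apply: eq_bigr => j _; rewrite [in RHS]E2 linear_sum summxE.
by apply: eq_bigr => i _; exact: rep_diag_swap.
Qed.

Lemma rep_trace_horner n e (Phi : {linear A -> 'M[R[i]]_n}) a rs q :
  matrix_rep e Phi -> a * family_sum n e = a ->
  char_poly (Phi a) = \prod_(z <- rs) ('X - z%:P) ->
  \tr (Phi (horner_alg a q)) = \sum_(z <- rs) q.[z].
Proof.
case: n Phi => [|n] Phi rPhi as_a Ers.
  have := size_char_poly (Phi a); rewrite Ers size_prod_XsubC => -[].
  by move/size0nil ->; rewrite big_nil /mxtrace big_ord0.
by rewrite (rep_horner _ rPhi as_a); exact: mxtrace_horner.
Qed.
End Trace.

(** * Superexponential decay under the commutator operator *)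

Section Decay.
Variables (R : realType) (A : banachAlgType R[i]) (a b : A).
Implicit Types (w x y : A) (n : nat) (l nu : R[i]).
Local Notation C := (commutator_op a b).

(** The order of [R[i]] compares only real numbers, so [d], and in fact [k] as
    well, are real. *)
Definition decaying w := forall d : R[i], 0 < d -> exists k : R[i],
  \forall n \near \oo, `|iter n C w| <= k * d ^+ n.

Lemma iter_commutator_mull n w : iter n C (a * w) = a * iter n C w.
Proof.
by elim: n => //= n ->; rewrite /commutator_op mulrBr !mulrA.
Qed.

Lemma iter_commutator_mulr n w : iter n C (w * b) = iter n C w * b.
Proof.
by elim: n => //= n ->; rewrite /commutator_op mulrBl !mulrA.
Qed.

Lemma iter_commutatorD n l x y :
  iter n C (x + l *: y) = iter n C x + l *: iter n C y.
Proof.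
elim: n => //= n ->; rewrite /commutator_op mulrDr mulrDl -scalerAr -scalerAl.
by rewrite scalerBr opprD addrACA.
Qed.

Lemma decayingD l x y : decaying x -> decaying y -> decaying (x + l *: y).
Proof.
move=> Sx Sy d d0; have [k xk] := Sx d d0; have [m ym] := Sy d d0.
exists (k + `|l| * m); apply: filterS2 xk ym => n xn yn.
rewrite iter_commutatorD (le_trans (ler_normD _ _)) // mulrDl lerD //.
by rewrite normrZ -mulrA ler_wpM2l.
Qed.

Lemma decaying_mull w : decaying w -> decaying (a * w).
Proof.
move=> Sw d d0; have [k wk] := Sw d d0; exists (`|a| * k).
apply: filterS wk => n wn; rewrite iter_commutator_mull.
by apply: le_trans (normrM_le _ _) _; rewrite -mulrA ler_wpM2l.
Qed.

Lemma decaying_mulr w : decaying w -> decaying (w * b).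
Proof.
move=> Sw d d0; have [k wk] := Sw d d0; exists (k * `|b|).
apply: filterS wk => n wn; rewrite iter_commutator_mulr.
by apply: le_trans (normrM_le _ _) _; rewrite mulrAC ler_wpM2r.
Qed.

(** Otherwise [|C^n w| = |nu|^n |w|], which is not O((|nu|/2)^n). *)
Lemma decaying_eigen w nu : decaying w -> C w = nu *: w -> nu != 0 -> w = 0.
Proof.
move=> Sw Cw nu0; apply/eqP; apply: contraT => w0.
have iterC n : iter n C w = nu ^+ n *: w.
  elim: n => [|n IH] /=; first by rewrite scale1r.
  rewrite IH /commutator_op -scalerAr -scalerAl -scalerBr -/(commutator_op a b w).
  by rewrite Cw scalerA exprSr.
have d0 : 0 < `|nu| / 2 by rewrite divr_gt0 ?normr_gt0.
have [k kP] := Sw _ d0.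
have H : \forall n \near \oo, `|w| * 2 ^+ n <= k.
  apply: filterS kP => n; rewrite iterC normrZ normrX expr_div_n mulrA.
  rewrite ler_pdivlMr ?exprn_gt0 // [k * _]mulrC -mulrA ler_pM2l //.
  by rewrite exprn_gt0 ?normr_gt0.
have w_gt0 : 0 < `|w| by rewrite normr_gt0.
have wE : (complex.Re `|w|)%:C = `|w| by apply: RRe_real; exact: normr_real.
have [N _ NP] := H.
have kE : (complex.Re k)%:C = k.
  apply/RRe_real/ger0_real; apply: le_trans (NP N (leqnn N)).
  by rewrite mulr_ge0 ?exprn_ge0.
pose M := complex.Re k / complex.Re `|w|.
have w_gt0' : 0 < complex.Re `|w| by rewrite -ltcR wE.
have := NP _ (leq_maxl N (Num.Def.archi_bound M)).
rewrite -wE -kE -[2](rmorph_nat (real_complex R)) -rmorphXn -rmorphM lecR.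
rewrite mulrC -ler_pdivlMr // leNgt.
by rewrite (upper_nthrootP (leq_maxr _ _)).
Qed.

(** By induction on [ls], [(a - l) w = 0] for the first root [l]; then [w] is an
    eigenvector of [C] for [l - nu]. *)
Lemma decaying_intertwiner1 w nu (ls : seq R[i]) : decaying w ->
  w * b = nu *: w -> horner_alg a (\prod_(z <- ls) ('X - z%:P)) * w = 0 ->
  nu \notin ls -> w = 0.
Proof.
elim: ls w => [|l ls IH] w Sw wb.
  by rewrite big_nil rmorph1 mul1r.
rewrite big_cons mulrC rmorphM rmorphB /= horner_algX horner_algC -mulrA => aw0.
rewrite inE negb_or => /andP [nul nuls].
have E : (a - l%:A) * w = a * w + (- l) *: w.
  by rewrite mulrBl mulr_algl scaleNr.
have w'0 : (a - l%:A) * w = 0.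
  apply: IH => //.
    by rewrite E; apply: decayingD => //; exact: decaying_mull.
  by rewrite -mulrA wb scalerAr.
apply: (@decaying_eigen w (l - nu)) => //; last by rewrite subr_eq0 eq_sym.
rewrite /commutator_op wb scalerBl; congr (_ - _).
by apply/eqP; rewrite -subr_eq0 -w'0 E scaleNr.
Qed.

(** A Sylvester type uniqueness statement; [decaying_intertwiner1] is the case
    of a single simple root on the right. *)
Lemma decaying_intertwiner w (ls ms : seq R[i]) : decaying w ->
  horner_alg a (\prod_(z <- ls) ('X - z%:P)) * w = 0 ->
  w * horner_alg b (\prod_(z <- ms) ('X - z%:P)) = 0 ->
  (forall z, z \in ms -> z \notin ls) -> w = 0.
Proof.
elim: ms w => [|m ms IH] w Sw aw.
  by rewrite big_nil rmorph1 mulr1.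
rewrite big_cons rmorphM rmorphB /= horner_algX horner_algC mulrA => wb0 lm.
have E : w * (b - m%:A) = w * b + (- m) *: w.
  by rewrite mulrBr mulr_algr scaleNr.
have w'0 : w * (b - m%:A) = 0.
  apply: IH => //.
  - by rewrite E; apply: decayingD => //; exact: decaying_mulr.
  - by rewrite mulrA aw mul0r.
  - by move=> z zms; apply: lm; rewrite inE zms orbT.
apply: (decaying_intertwiner1 Sw) aw (lm m (mem_head _ _)).
by apply/eqP; rewrite -subr_eq0 -w'0 E scaleNr.
Qed.

Lemma decaying_horner w f g : decaying w ->
  decaying (horner_alg a f * w * horner_alg b g).
Proof.
have S0 x : decaying x -> decaying 0.
  by move=> Sx; rewrite -(subrr x) -scaleN1r; exact: decayingD.
elim/poly_ind: f w => [|f c IHf] w Sw.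
  by rewrite rmorph0 !mul0r; exact: S0 Sw.
rewrite rmorphD rmorphM /= horner_algX horner_algC !mulrDl mulr_algl.
rewrite -(mulrA _ a) -scalerAl; apply: decayingD.
  by apply: IHf; exact: decaying_mull.
elim/poly_ind: g {f c IHf} w Sw => [|g d IHg] w Sw.
  by rewrite rmorph0 mulr0; exact: S0 Sw.
rewrite rmorphD rmorphM /= horner_algX horner_algC mulrDr mulr_algr.
rewrite horner_algMX mulrA; apply: decayingD => //.
by apply: IHg; exact: decaying_mulr.
Qed.

Lemma decaying_annihilated f g (ls ms : seq R[i]) : decaying 1 ->
  horner_alg a (\prod_(z <- ls) ('X - z%:P) * f) = 0 ->
  horner_alg b (g * \prod_(z <- ms) ('X - z%:P)) = 0 ->
  (forall z, z \in ms -> z \notin ls) ->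
  horner_alg a f * horner_alg b g = 0.
Proof.
move=> S1; rewrite !rmorphM => af bg lm.
apply: (decaying_intertwiner (ls := ls) (ms := ms)) => //.
- by rewrite -[horner_alg a f]mulr1; exact: decaying_horner.
- by rewrite mulrA af mul0r.
- by rewrite -mulrA bg mulr0.
Qed.
End Decay.

Lemma rho_decaying (R : realType) (A : banachAlgType R[i]) (a b : A) :
  rho a b = 0%E -> decaying a b 1.
Proof.
move=> rho0 d d0.
have dE : (complex.Re d)%:C = d by apply/RRe_real/gtr0_real.
have d0' : 0 < complex.Re d by rewrite -ltcR dE.
have : (rho a b < (complex.Re d)%:E)%E by rewrite rho0 lte_fin.
move=> /ereal_inf_lt [_ [V Voo <-] supV]; exists 1.
have V1 : \forall n \near \oo, V n := Voo.
(* The n-th root can be undone only for [n >= 1]. *)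
apply: filterS2 V1 (nbhs_infty_ge 1) => n Vn n1.
set x := iter n _ _; rewrite mul1r.
have xE : (complex.Re `|x|)%:C = `|x| by apply/RRe_real/normr_real.
have x0 : 0 <= complex.Re `|x| by rewrite -lecR xE; exact: normr_ge0.
rewrite -xE -dE -rmorphXn lecR.
have : ((complex.Re `|x| `^ n%:R^-1)%:E < (complex.Re d)%:E)%E.
  by apply: le_lt_trans supV; apply: ereal_sup_ubound; exists n.
rewrite lte_fin => lt_d.
have -> : complex.Re `|x| = (complex.Re `|x| `^ n%:R^-1) ^+ n.
  by rewrite -powR_mulrn ?powR_ge0 // -powRrM mulVf ?powRr1 // pnatr_eq0 -lt0n.
by rewrite lerXn2r ?nnegrE ?powR_ge0 // ltW.
Qed.

Lemma decaying_scale (R : realType) (A : banachAlgType R[i]) (a b : A) l :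
  decaying a b 1 -> decaying (l *: a) (l *: b) 1.
Proof.
have iterZ n : iter n (commutator_op (l *: a) (l *: b)) 1 =
    l ^+ n *: iter n (commutator_op a b) 1.
  elim: n => [|n IH] /=; first by rewrite scale1r.
  rewrite IH {1}/commutator_op; set w := iter n _ _.
  have -> : l *: a * (l ^+ n *: w) = l ^+ n.+1 *: (a * w).
    by rewrite -scalerAr -scalerAl scalerA -exprSr.
  have -> : l ^+ n *: w * (l *: b) = l ^+ n.+1 *: (w * b).
    by rewrite -scalerAl -scalerAr scalerA -exprSr.
  by rewrite -scalerBr.
move=> S1 d d0; have l0 : 0 < 1 + `|l| by rewrite ltr_wpDr.
have [k kP] := S1 _ (divr_gt0 d0 l0).
exists k; apply: filterS kP => n kn; rewrite iterZ normrZ normrX.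
have k0 : 0 <= k.
  rewrite -(pmulr_lge0 _ (exprn_gt0 n (divr_gt0 d0 l0))).
  exact: le_trans kn.
apply: (@le_trans _ _ (`|l| ^+ n * (k * (d / (1 + `|l|)) ^+ n))).
  by rewrite ler_wpM2l ?exprn_ge0.
have ld : `|l| * (d / (1 + `|l|)) <= d.
  by rewrite mulrA ler_pdivrMr // mulrC ler_pM2l // lerDr.
have ld0 : 0 <= `|l| * (d / (1 + `|l|)).
  by rewrite mulr_ge0 // divr_ge0 // ltW.
by rewrite mulrCA ler_wpM2l // -exprMn lerXn2r // nnegrE ltW.
Qed.

(** * Comparison of the two determinants *)

Lemma socle_scale (R : realType) (A : banachAlgType R[i]) (a : A) l :
  socle a -> socle (l *: a).
Proof.
move=> [t [t1 ->]]; have [->|l0] := eqVneq l 0.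
  by exists [::]; rewrite big_nil scale0r.
exists [seq l *: u | u <- t]; split; last by rewrite big_map scaler_sumr.
move=> _ /mapP [u ut ->]; have [u0 uAu] := t1 u ut.
split; first by rewrite scaler_eq0 negb_or l0.
move=> x; have [k uk] := uAu x; exists (l * k).
by rewrite -!scalerAl -scalerAr uk !scalerA -!mulrA [k * l]mulrC.
Qed.

Lemma coprimep_prod_XsubC (F : fieldType) (p : {poly F}) (ls : seq F) :
  (forall z, z \in ls -> ~~ root p z) ->
  coprimep p (\prod_(z <- ls) ('X - z%:P)).
Proof.
elim: ls => [|z ls IH] H; first by rewrite big_nil coprimep1.
rewrite big_cons coprimepMr coprimep_XsubC H ?mem_head //=.
by apply: IH => w wls; apply: H; rewrite inE wls orbT.
Qed.

Section Comparison.
Variables (R : realType) (A : banachAlgType R[i]).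
Variables (a b : A).
Hypothesis S1 : decaying a b 1.

Variables (n : nat) (e : nat -> A) (Phi : {linear A -> 'M[R[i]]_n}) (rs : seq R[i]).
Hypotheses (fe : orthogonal_family n e) (rPhi : matrix_rep e Phi)
  (ae : a * family_sum n e = a)
  (Ers : char_poly (Phi a) = \prod_(z <- rs) ('X - z%:P)).
Variables (m : nat) (e' : nat -> A) (Phi' : {linear A -> 'M[R[i]]_m}) (rs' : seq R[i]).
Hypotheses (fe' : orthogonal_family m e') (rPhi' : matrix_rep e' Phi')
  (be : b * family_sum m e' = b)
  (Ers' : char_poly (Phi' b) = \prod_(z <- rs') ('X - z%:P)).

(** [P1] is the power of ['X - mu] and [P2] the part prime to it in a common
    annihilator [P1 * P2] of [a] and [b], so that [Q = v P2] with
    [v P2 + u P1 = 1] yields the spectral idempotents at [mu]. *)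
Lemma decaying_same_multiplicity mu :
  mu != 0 -> count_mem mu rs = count_mem mu rs'.
Proof.
move=> mu0; pose L := mu :: 0 :: rs ++ rs'.
pose ls := [seq z <- L | z == mu]; pose ms := [seq z <- L | z != mu].
pose P1 := \prod_(z <- ls) ('X - z%:P); pose P2 := \prod_(z <- ms) ('X - z%:P).
pose X1 : {poly R[i]} := 'X - mu%:P.
have P12 : P1 * P2 = X1 * ('X * (char_poly (Phi a) * char_poly (Phi' b))).
  transitivity (\prod_(z <- L) ('X - z%:P)).
    by rewrite /P1 /P2 /ls /ms !big_filter [RHS](bigID (pred1 mu)).
  rewrite /L !big_cons big_cat Ers Ers'.
  by rewrite polyC0 subr0.
have P12a : horner_alg a (P1 * P2) = 0.
  have -> : P1 * P2 = 'X * char_poly (Phi a) * (X1 * char_poly (Phi' b)).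
    by rewrite P12 mulrACA [X1 * _]mulrC mulrAC.
  by rewrite rmorphM /= (rep_annihilator rPhi ae) mul0r.
have P12b : horner_alg b (P1 * P2) = 0.
  have -> : P1 * P2 = 'X * char_poly (Phi' b) * (X1 * char_poly (Phi a)).
    by rewrite P12 mulrACA [char_poly _ * _]mulrC [X1 * _]mulrC mulrAC.
  by rewrite rmorphM /= (rep_annihilator rPhi' be) mul0r.
have : coprimep P2 P1.
  apply: coprimep_prod_XsubC => z; rewrite root_prod_XsubC !mem_filter.
  by move=> /andP [/eqP -> _]; rewrite eqxx.
move=> /Bezout_eq1_coprimepP [[v u] /= uv].
pose Q := v * P2; have Q1 : 1 - Q = u * P1 by rewrite -uv addrC addKr.
have lm z : z \in ms -> z \notin ls.
  by rewrite !mem_filter => /andP [/negPf ->].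
have ml z : z \in ls -> z \notin ms.
  by rewrite !mem_filter => /andP [-> ].
have ab0 : horner_alg a Q * horner_alg b (1 - Q) = 0.
  apply: (decaying_annihilated S1 _ _ lm).
    by rewrite -/P1 /Q mulrCA rmorphM /= P12a mulr0.
  by rewrite -/P2 Q1 -mulrA rmorphM /= P12b mulr0.
have ba0 : horner_alg a (1 - Q) * horner_alg b Q = 0.
  apply: (decaying_annihilated S1 _ _ ml).
    by rewrite -/P2 Q1 mulrCA [P2 * _]mulrC rmorphM /= P12a mulr0.
  by rewrite -/P1 /Q -mulrA [P2 * _]mulrC rmorphM /= P12b mulr0.
have Qab : horner_alg a Q * horner_alg b Q = horner_alg a Q.
  by apply/eqP; rewrite eq_sym -subr_eq0; move: ab0;
     rewrite rmorphB rmorph1 mulrBr mulr1 => ->.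
have Qba : horner_alg a Q * horner_alg b Q = horner_alg b Q.
  by apply/eqP; rewrite eq_sym -subr_eq0; move: ba0;
     rewrite rmorphB rmorph1 mulrBl mul1r => ->.
have Qeq : horner_alg a Q = horner_alg b Q by rewrite -Qab.
have Qroot z : z \in L -> Q.[z] = (z == mu)%:R.
  move=> zL; rewrite hornerM; have [->|zmu] := eqVneq z mu.
    have /(congr1 (horner^~ mu)) := uv; rewrite hornerD !hornerM hornerC /=.
    have -> : P1.[mu] = 0.
      by apply/rootP; rewrite root_prod_XsubC mem_filter eqxx mem_head.
    by rewrite mulr0 addr0.
  have -> : P2.[z] = 0.
    by apply/rootP; rewrite root_prod_XsubC mem_filter zmu.
  by rewrite mulr0.
(* As [Q] has no constant term, [Q(a)] is in [A a] and [Q(b)] in [A b]. *)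
have [Q' QE] : exists Q', Q = Q' * 'X.
  have /factor_theorem [Q' QE] : root Q 0.
    by apply/rootP; rewrite Qroot ?inE ?eqxx ?orbT // eq_sym (negPf mu0).
  by exists Q'; rewrite QE polyC0 subr0.
have sumQ (s : seq R[i]) : {subset s <= L} ->
    \sum_(z <- s) Q.[z] = (count_mem mu s)%:R.
  move=> sL; rewrite -sum1_count natr_sum [RHS]big_mkcond /= big_seq [RHS]big_seq.
  by apply: eq_bigr => z /sL /Qroot ->; case: eqP.
have supp c k g : c * family_sum k g = c ->
    horner_alg c Q * family_sum k g = horner_alg c Q.
  by move=> cs; rewrite QE rmorphM /= horner_algX -mulrA cs.
have : ((count_mem mu rs)%:R : R[i]) = (count_mem mu rs')%:R.
  rewrite -!sumQ; [|by move=> z zr; rewrite !inE mem_cat zr !orbT..].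
  rewrite -(rep_trace_horner _ rPhi ae Ers) -(rep_trace_horner _ rPhi' be Ers').
  rewrite -Qeq; apply: rep_trace_indep fe rPhi fe' rPhi' _ _ _.
  - by rewrite {2}Qeq.
  - exact: supp.
  - by rewrite Qeq; exact: supp.
by move=> /eqP; rewrite eqr_nat => /eqP.
Qed.
End Comparison.

(** The factors at nonzero points agree by [decaying_same_multiplicity]; the
    factor at 0, which may belong to one spectrum only, is 1. *)
Theorem det1D_decaying (R : realType) (A : banachAlgType R[i]) (a b : A) :
  semisimple A -> socle a -> socle b -> decaying a b 1 -> det1D a = det1D b.
Proof.
move=> ssA Sa Sb S1.
have [n [e [fe ae [y sy]]]] := socle_support ssA Sa.
have [m [e' [fe' be [y' sy']]]] := socle_support ssA Sb.
have [Phi rPhi] := matrix_rep_exists ssA fe.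
have [Phi' rPhi'] := matrix_rep_exists ssA fe'.
have [rs Ers _] := monic_factor (char_poly_monic (Phi a)).
have [rs' Ers' _] := monic_factor (char_poly_monic (Phi' b)).
have cE := decaying_same_multiplicity S1 fe rPhi ae Ers fe' rPhi' be Ers'.
have spE : nonzero_spectrum a = nonzero_spectrum b.
  apply/seteqP; split=> mu.
    move=> /(nonzero_spectrum_count rPhi ae Ers) [mu0 c0].
    by apply/(nonzero_spectrum_count rPhi' be Ers'); rewrite -cE.
  move=> /(nonzero_spectrum_count rPhi' be Ers') [mu0 c0].
  by apply/(nonzero_spectrum_count rPhi ae Ers); rewrite cE.
have detE (c : A) : det1D c =
    \big[*%R/1]_(mu \in nonzero_spectrum c) (1 + mu) ^+ multiplicity mu c.
  rewrite /det1D; symmetry; apply: fsbig_widen; first exact: subIsetl.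
  move=> mu [smu nmu]; rewrite /= /preimage /=.
  have -> : mu = 0 by apply: contrapT => mu0; apply: nmu; split.
  by rewrite addr0 expr1n.
rewrite !detE spE; apply: eq_fsbigr => mu.
rewrite inE => /(nonzero_spectrum_count rPhi' be Ers') [mu0 _].
rewrite (multiplicity_count fe rPhi ae sy Ers mu0).
by rewrite (multiplicity_count fe' rPhi' be sy' Ers' mu0) cE.
Qed.

Theorem corollary3p5 (R : realType) (A : banachAlgType R[i]) (a b : A) :
  semisimple A -> socle a -> socle b -> rho a b = 0%E ->
  forall l : R[i], det1D (l *: a) = det1D (l *: b).
Proof.
move=> ssA Sa Sb rho0 l.
apply: det1D_decaying => //; try exact: socle_scale.
by apply: decaying_scale; exact: rho_decaying.
Qed.
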